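(* The Davis hyperbolic 4-manifold $M=\Gamma\backslash H^4$ has a unique fully symmetric spin structure.
   Context: The Davis hyperbolic 4-manifold is $M=\Gamma\backslash H^4$, where $\Gamma\subset \mathrm{SO}^+(4,1)$ is the torsion-free discrete group generated by the 120 side-pairing maps of a regular hyperbolic 120-cell $\mathcal C$ with dihedral angle $2\pi/5$ that glue each side of $\mathcal C$ to its opposite side by the hyperbolic translation whose axis passes through the center of $\mathcal C$. Let $\eta:\mathrm{Spin}^+(4,1)\to \mathrm{SO}^+(4,1)$ be the double covering epimorphism. A spin structure on $M$ is given by a subgroup $\hat\Gamma$ of $\mathrm{Spin}^+(4,1)$ mapped isomorphically onto $\Gamma$ by $\eta$, the spin structure being $\hat\Gamma\backslash \mathrm{Spin}^+(4,1)$. If $N(\Gamma)$ is the normalizer of $\Gamma$ in $\mathrm{SO}^+(4,1)$, the orientation-preserving isometries of $M$ are exactly the maps $f_\star(\Gamma x)=\Gamma fx$ with $f\in N(\Gamma)$; the symmetries of the spin structure are the maps $\hat f_\star(\hat\Gamma\hat g)=\hat\Gamma\hat f\hat g$ with $\hat f$ in the normalizer $N(\hat\Gamma)$ of $\hat\Gamma$ in $\mathrm{Spin}^+(4,1)$, and $\hat f_\star$ lifts $f_\star$ where $f=\eta(\hat f)$. The spin structure is fully symmetric if every orientation-preserving isometry of $M$ lifts to a symmetry of the spin structure. *)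

(* Defs.v *)
From mathcomp Require Import all_boot all_order all_algebra all_fingroup.
From mathcomp Require Import reals.
Set Implicit Arguments.
Unset Strict Implicit.
Unset Printing Implicit Defensive.
Import Order.TTheory GRing.Theory Num.Theory.
Local Open Scope ring_scope.

Section Davis.
Variable R : realType.

Definition lorJ : 'M[R]_5 := \matrix_(i, j) (if i == j then (if i == 0 then -1 else 1) else 0).

(* SO^+(4,1): preserves the form, determinant 1, preserves the upper
   sheet of the hyperboloid (time orientation). *)
Definition SOplus (A : 'M[R]_5) : Prop :=
  A^T *m lorJ *m A = lorJ /\ \det A = 1 /\ 0 < A 0 0.

(* The regular hyperbolic 120-cell C with dihedral angle 2pi/5, centred
   at e0 = (1,0,0,0,0) in the hyperboloid model.  The outward unit
   directions (in the tangent space R^4 at e0) of its 120 sides are the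
   120 vertices of the regular 600-cell: *)
Definition phi : R := (1 + Num.sqrt 5) / 2.

Definition base600 (j : 'I_4) : R :=
  if val j == 0%N then phi / 2 else if val j == 1%N then 1 / 2
  else if val j == 2%N then 1 / (2 * phi) else 0.

Definition facet_dir (u : 'I_4 -> R) : Prop :=
  (exists i : 'I_4, exists e : bool,
      forall j, u j = if j == i then (-1) ^+ e else 0)
  \/ (exists e : 'I_4 -> bool, forall j, u j = (-1) ^+ e j / 2)
  \/ (exists p : 'S_4, ~~ odd_perm p /\
        exists e : 'I_4 -> bool, forall j, u (p j) = (-1) ^+ e j * base600 j).

(* Inradius r of C (distance from the centre to each side): the side with
   outward direction u lies in the hyperplane with spacelike unit normal
   (sinh r, cosh r u); the dihedral angle 2pi/5 between adjacent sides
   (whose directions make the angle pi/5) forces cosh r = phi^2. *)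
Definition cosh_r : R := phi ^+ 2.
Definition sinh_r : R := Num.sqrt (cosh_r ^+ 2 - 1).
(* The side pairing is the hyperbolic translation by 2r along the axis
   through the centre in direction u; it maps the side with direction -u
   onto the side with direction u.  cosh 2r, sinh 2r : *)
Definition cosh_2r : R := 2 * cosh_r ^+ 2 - 1.
Definition sinh_2r : R := 2 * sinh_r * cosh_r.

Definition ext_dir (u : 'I_4 -> R) (k : 'I_5) : R :=
  if k == 0 then 0 else u (inord k.-1).

(* Lorentz boost (hyperbolic translation) of length 2r in direction u. *)
Definition side_pairing (u : 'I_4 -> R) : 'M[R]_5 :=
  \matrix_(i, j)
    (if i == 0 then (if j == 0 then cosh_2r else sinh_2r * ext_dir u j)
     else if j == 0 then sinh_2r * ext_dir u i
     else (i == j)%:R + (cosh_2r - 1) * ext_dir u i * ext_dir u j).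

Definition side_pairings (g : 'M[R]_5) : Prop :=
  exists u, facet_dir u /\ g = side_pairing u.

Inductive gen_group (S : 'M[R]_5 -> Prop) : 'M[R]_5 -> Prop :=
  | gen_one : gen_group S 1%:M
  | gen_elt g : S g -> gen_group S g
  | gen_mul g h : gen_group S g -> gen_group S h -> gen_group S (g *m h)
  | gen_inv g : gen_group S g -> gen_group S (invmx g).

Definition Gamma (g : 'M[R]_5) : Prop := gen_group side_pairings g.

Definition normalizer_Gamma (f : 'M[R]_5) : Prop :=
  SOplus f /\
  (forall g, Gamma g -> Gamma (f *m g *m invmx f)) /\
  (forall h, Gamma h -> exists g, Gamma g /\ h = f *m g *m invmx f).

(* The real Clifford algebra Cl(R^{4,1}) with e_i^2 = <e_i,e_i>
   (e_0^2 = -1, e_i^2 = 1 for i >= 1), in the blade basis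
   e_A = e_{a1} ... e_{ak}  (A = {a1 < ... < ak} a subset of {0..4}). *)
Definition Cl := {ffun {set 'I_5} -> R}.

Definition qsq (i : 'I_5) : R := if i == 0 then -1 else 1.

(* e_A e_B = blade_sign A B * e_{A Delta B} *)
Definition blade_sign (A B : {set 'I_5}) : R :=
  (-1) ^+ #|[set p : 'I_5 * 'I_5 | (p.1 \in A) && (p.2 \in B) && (p.2 < p.1)%N]|
  * \prod_(i in A :&: B) qsq i.

Definition symdiff (A B : {set 'I_5}) : {set 'I_5} := (A :\: B) :|: (B :\: A).

Definition clmul (x y : Cl) : Cl :=
  [ffun C => \sum_(A : {set 'I_5}) \sum_(B : {set 'I_5} | symdiff A B == C)
               blade_sign A B * x A * y B].

Definition clone : Cl := [ffun A : {set 'I_5} => (A == set0)%:R].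

(* reversion: e_{a1}...e_{ak} |-> e_{ak}...e_{a1} *)
Definition clrev (x : Cl) : Cl := [ffun A : {set 'I_5} => (-1) ^+ 'C(#|A|, 2) * x A].

Definition clvec (v : 'I_5 -> R) : Cl :=
  [ffun A : {set 'I_5} => \sum_(i < 5) (A == [set i])%:R * v i].

Definition is_vector (x : Cl) : Prop := forall A : {set 'I_5}, #|A| != 1%N -> x A = 0.
Definition is_even (x : Cl) : Prop := forall A : {set 'I_5}, odd #|A| -> x A = 0.

(* Spin^+(4,1): even elements s with s s~ = 1 whose (twisted) adjoint
   action v |-> s v s^{-1} = s v s~ preserves R^{4,1}.  Its inverse is s~. *)
Definition Spinplus (s : Cl) : Prop :=
  is_even s /\ clmul s (clrev s) = clone /\
  (forall v, is_vector (clmul (clmul s (clvec v)) (clrev s))).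

Definition eta (s : Cl) : 'M[R]_5 :=
  \matrix_(i, j) (clmul (clmul s (clvec (fun k => (k == j)%:R))) (clrev s)) [set i].

(* Subgroup hG of Spin^+(4,1) mapped isomorphically onto Gamma by eta:
   a spin structure on M. *)
Definition spin_structure (hG : Cl -> Prop) : Prop :=
  (forall x, hG x -> Spinplus x) /\
  hG clone /\
  (forall x y, hG x -> hG y -> hG (clmul x y)) /\
  (forall x, hG x -> hG (clrev x)) /\
  (forall x y, hG x -> hG y -> eta x = eta y -> x = y) /\
  (forall g, Gamma g <-> exists x, hG x /\ eta x = g).

Definition normalizer_spin (hG : Cl -> Prop) (fh : Cl) : Prop :=
  Spinplus fh /\
  (forall x, hG x -> hG (clmul (clmul fh x) (clrev fh))) /\
  (forall y, hG y -> exists x, hG x /\ y = clmul (clmul fh x) (clrev fh)).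

(* Fully symmetric: every orientation-preserving isometry f_* of M
   (f in N(Gamma)) lifts to a symmetry fh_* of the spin structure, i.e.
   there is fh in N(hG) with (eta fh)_* = f_* as maps of
   Gamma\SO^+(4,1):  Gamma (eta fh) x = Gamma f x for all x. *)
Definition fully_symmetric (hG : Cl -> Prop) : Prop :=
  forall f, normalizer_Gamma f ->
    exists fh, normalizer_spin hG fh /\
      (forall x, SOplus x -> exists g, Gamma g /\ eta fh *m x = g *m f *m x).

End Davis.

(* Main.v *)
(** For a facet direction u let N be the unit normal of the side it determines.  The side pairing
    is the product of the reflections in N and in u, so it is covered by N u = cosh r + sinh r e_0 u
    and by its opposite.  All coefficients lie in Z[1/2, p] with p = 5^(1/4), where cosh r = phi^2
    and sinh r = p phi; modulo p, whose residue field is F_5, cosh r = -1 and sinh r = 0.  Hence - N u is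
    congruent to 1 modulo p, and every element of Gamma has exactly one lift congruent to 1.

    Existence: these lifts form a group, and they are singled out among all lifts of elements of
    Gamma by their scalar part being 1 modulo p.  The scalar part is invariant under conjugation,
    so the group is normalized by every lift of an element of N(Gamma); such lifts exist because an
    element of SO^+(4,1) is a product of reflections in spacelike vectors.

    Uniqueness: the five sides around a ridge give a relation of odd length among conjugates of a
    single side pairing by rotations of the 120-cell.  Full symmetry forces these five conjugates to
    have the same sign with respect to the lifts above, and the relation forces that sign to be 1. *)
From HB Require Import structures.
Require Import Defs.
From mathcomp Require Import all_boot all_order all_algebra all_fingroup.
From mathcomp Require Import reals ring lra zify.
Set Implicit Arguments.
Unset Strict Implicit.
Unset Printing Implicit Defensive.
Import Order.TTheory GRing.Theory Num.Theory.
Local Open Scope ring_scope.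

(** * Clifford multiplication *)

Section Clifford.
Variable R : realType.
Implicit Types (A B C : {set 'I_5}) (x y z : Cl R).

Lemma in_symdiff A B i : (i \in symdiff A B) = (i \in A) (+) (i \in B).
Proof. by rewrite !inE; case: (i \in A); case: (i \in B). Qed.

Lemma symdiffA A B C : symdiff A (symdiff B C) = symdiff (symdiff A B) C.
Proof. by apply/setP => i; rewrite !in_symdiff addbA. Qed.

Lemma symdiffC A B : symdiff A B = symdiff B A.
Proof. by apply/setP => i; rewrite !in_symdiff addbC. Qed.

Lemma symdiff0s A : symdiff set0 A = A.
Proof. by apply/setP => i; rewrite in_symdiff inE. Qed.

Lemma symdiffs0 A : symdiff A set0 = A.
Proof. by rewrite symdiffC symdiff0s. Qed.

Lemma symdiffss A : symdiff A A = set0.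
Proof. by apply/setP => i; rewrite in_symdiff addbb inE. Qed.

Lemma symdiffK A : cancel (symdiff A) (symdiff A).
Proof. by move=> B; rewrite symdiffA symdiffss symdiff0s. Qed.

Lemma symdiff_eq A B C : (symdiff A B == C) = (B == symdiff A C).
Proof. by apply/eqP/eqP => [<-|->]; rewrite symdiffK. Qed.

Lemma symdiff_eq0 A B : (symdiff A B == set0) = (A == B).
Proof. by rewrite symdiff_eq symdiffs0 eq_sym. Qed.

Lemma prod_symdiff (f : 'I_5 -> R) A B : (forall i, f i * f i = 1) ->
  \prod_(i in symdiff A B) f i = \prod_(i in A) f i * \prod_(i in B) f i.
Proof.
move=> ff; rewrite big_mkcond (big_mkcond (mem A)) (big_mkcond (mem B)) -big_split /=.
apply: eq_bigr => i _.
rewrite in_symdiff; case: (i \in A); case: (i \in B) => //=;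
  by rewrite ?mulr1 ?mul1r ?ff.
Qed.

Definition inversion_sign (i j : 'I_5) : R := if (j < i)%N then -1 else 1.

Definition pair_sign (i j : 'I_5) : R :=
  inversion_sign i j * (if i == j then qsq R i else 1).

(** Subsets of ['I_5] form an elementary abelian 2-group under [symdiff]. A product of signs over
    [A] and [B] is bimultiplicative on it, because the factors over a common element cancel in
    pairs. *)
Definition bichar (k : 'I_5 -> 'I_5 -> R) A B : R :=
  \prod_(i in A) \prod_(j in B) k i j.

Lemma inversion_sign_sqr i j : inversion_sign i j * inversion_sign i j = 1.
Proof. by rewrite /inversion_sign; case: ifP => _; ring. Qed.

Lemma qsq_sqr i : qsq R i * qsq R i = 1.
Proof. by rewrite /qsq; case: ifP => _; ring. Qed.

Lemma pair_sign_sqr i j : pair_sign i j * pair_sign i j = 1.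
Proof.
rewrite /pair_sign mulrACA inversion_sign_sqr mul1r.
by case: ifP => _; rewrite ?qsq_sqr ?mulr1.
Qed.

Lemma bichar_sqr k A B : (forall i j, k i j * k i j = 1) ->
  bichar k A B * bichar k A B = 1.
Proof.
move=> kk; rewrite /bichar -big_split big1 //= => i _.
by rewrite -big_split big1 //= => j _; rewrite kk.
Qed.

Lemma bicharDl k A B C : (forall i j, k i j * k i j = 1) ->
  bichar k (symdiff A B) C = bichar k A C * bichar k B C.
Proof.
move=> kk; rewrite /bichar; apply: prod_symdiff => i.
by rewrite -big_split big1 //= => j _; rewrite kk.
Qed.

Lemma bicharDr k A B C : (forall i j, k i j * k i j = 1) ->
  bichar k A (symdiff B C) = bichar k A B * bichar k A C.
Proof.
move=> kk; rewrite /bichar -big_split /=; apply: eq_bigr => i _.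
exact: prod_symdiff.
Qed.

Lemma inversion_count A B :
  (-1) ^+ #|[set p : 'I_5 * 'I_5 | (p.1 \in A) && (p.2 \in B) && (p.2 < p.1)%N]|
  = bichar inversion_sign A B.
Proof.
rewrite -prodr_const /bichar pair_big_dep /= big_mkcond [RHS]big_mkcond /=.
apply: eq_bigr => p _; rewrite inE /inversion_sign.
by case: (p.1 \in A); case: (p.2 \in B); case: ifP.
Qed.

(** The inversion count supplies the factors [inversion_sign]; the product of [qsq] over the
    intersection is the diagonal part of the double product. *)
Lemma blade_signE A B : blade_sign R A B = bichar pair_sign A B.
Proof.
rewrite /blade_sign inversion_count /bichar.
under [RHS]eq_bigr => i _ do rewrite big_split /=.
rewrite big_split /=; congr (_ * _).
rewrite big_mkcond [RHS]big_mkcond /=; apply: eq_bigr => i _.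
rewrite inE; case: (i \in A) => //=.
rewrite -big_mkcondr /=; case: ifP => iB.
  by rewrite (big_pred1 i) // => j /=; case: (eqVneq i j) => [<-|_]; rewrite ?iB ?andbF.
by rewrite big1 // => j /andP[jB /eqP ij]; move: iB; rewrite ij jB.
Qed.

Lemma blade_sign_sqr A B : blade_sign R A B * blade_sign R A B = 1.
Proof. by rewrite blade_signE bichar_sqr //; exact: pair_sign_sqr. Qed.

Lemma blade_signDl A B C :
  blade_sign R (symdiff A B) C = blade_sign R A C * blade_sign R B C.
Proof. by rewrite !blade_signE bicharDl //; exact: pair_sign_sqr. Qed.

Lemma blade_signDr A B C :
  blade_sign R A (symdiff B C) = blade_sign R A B * blade_sign R A C.
Proof. by rewrite !blade_signE bicharDr //; exact: pair_sign_sqr. Qed.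

Lemma blade_sign0s A : blade_sign R set0 A = 1.
Proof. by rewrite blade_signE /bichar big_set0. Qed.

Lemma blade_signs0 A : blade_sign R A set0 = 1.
Proof. by rewrite blade_signE /bichar big1 // => i _; rewrite big_set0. Qed.

(** Off the diagonal, the pairs in [A] x [A] form two classes exchanged by swapping. This turns the
    reversion sign into [bichar inversion_sign A A]. *)
Lemma inversion_countss A :
  #|[set p : 'I_5 * 'I_5 | (p.1 \in A) && (p.2 \in A) && (p.2 < p.1)%N]| = 'C(#|A|, 2).
Proof.
set I := [set p | _].
have cI' : #|[set p : 'I_5 * 'I_5 | (p.1 \in A) && (p.2 \in A) && (p.1 < p.2)%N]| = #|I|.
  rewrite -[RHS](card_imset _ (can_inj (@swap_pairK _ _))); apply: eq_card => p.
  rewrite [in LHS]inE; apply/idP/imsetP => [H|[q]].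
    by exists (p.2, p.1); rewrite ?inE /=; move: H; case: (p.1 \in A); case: (p.2 \in A) => //; case: p.
  by rewrite inE => H -> /=; move: H; case: (q.1 \in A); case: (q.2 \in A).
have : (#|setX A A| = #|A| + (#|I| + #|I|))%N.
  have inj_diag : injective (fun i : 'I_5 => (i, i)) by move=> i j [].
  rewrite -{2}cI' -(card_imset A inj_diag) -!sum1_card big_mkcond /=.
  rewrite (big_mkcond (mem [set (i, i) | i in A])) (big_mkcond (mem I)) /=.
  rewrite (big_mkcond (mem [set p | _])) -!big_split /=.
  apply: eq_bigr => p _; rewrite !inE.
  have -> : (p \in [set (i, i) | i in A]) = (p.1 \in A) && (p.1 == p.2).
    apply/imsetP/andP => [[i iA ->]|[pA /eqP e]]; first by rewrite /= iA eqxx.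
    by exists p.1 => //; case: p e {pA} => a b /= ->.
  case: (eqVneq p.1 p.2) => [<-|ne]; first by rewrite ltnn !andbF andbT andbb; case: (p.1 \in A).
  by rewrite andbF; case: (p.1 \in A); case: (p.2 \in A) => //=; case: ltngtP => // e; case/eqP: ne; apply: val_inj.
rewrite cardsX bin2 => e; rewrite -divn2.
have -> : (#|A| * #|A|.-1 = #|I| * 2)%N by move: e; case: #|A| => [|n] /=; lia.
by rewrite mulnK.
Qed.

Lemma clrevE x A : clrev x A = bichar inversion_sign A A * x A.
Proof. by rewrite ffunE -inversion_countss inversion_count. Qed.

Lemma clmulE x y C :
  clmul x y C = \sum_A blade_sign R A (symdiff A C) * x A * y (symdiff A C).
Proof.
rewrite ffunE; apply: eq_bigr => A _.
by rewrite (big_pred1 (symdiff A C)) // => B; rewrite symdiff_eq.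
Qed.

Lemma clmulA : associative (@clmul R).
Proof.
move=> x y z; apply/ffunP => D; rewrite !clmulE.
under [LHS]eq_bigr => A _ do rewrite clmulE mulr_sumr.
under [RHS]eq_bigr => B _ do rewrite clmulE mulr_sumr mulr_suml.
rewrite [RHS]exchange_big; apply: eq_bigr => A _ /=.
(* After reindexing, [A] and [B] are the blades taken from [x] and [y] on both sides.
   Bimultiplicativity then makes the two signs agree up to the square of [blade_sign A B]. *)
rewrite [RHS](reindex_inj (can_inj (symdiffK A))); apply: eq_bigr => B _ /=.
rewrite !symdiffK.
have -> : symdiff B (symdiff A D) = symdiff (symdiff A B) D by rewrite symdiffA (symdiffC B).
rewrite !(blade_signDl, blade_signDr).
have e1 := blade_sign_sqr A B.
set a := blade_sign R A A; set b := blade_sign R A B in e1 *.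
ring: e1.
Qed.

Lemma cl1mul : left_id (@clone R) (@clmul R).
Proof.
move=> x; apply/ffunP => C; rewrite clmulE (bigD1 set0) //= big1 ?addr0.
  by rewrite ffunE eqxx blade_sign0s symdiff0s !mul1r.
by move=> A A0; rewrite ffunE (negbTE A0) mulr0 mul0r.
Qed.

Lemma clmul1 : right_id (@clone R) (@clmul R).
Proof.
move=> x; apply/ffunP => C; rewrite clmulE (bigD1 C) //= big1 ?addr0.
  by rewrite ffunE symdiffss eqxx blade_signs0 !mul1r mulr1.
by move=> A neAC; rewrite ffunE symdiff_eq0 (negbTE neAC) mulr0.
Qed.

Lemma clmulDl : left_distributive (@clmul R) +%R.
Proof.
move=> x y z; apply/ffunP => C; rewrite [RHS]ffunE !clmulE -big_split /=.
by apply: eq_bigr => A _; rewrite ffunE mulrDr mulrDl.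
Qed.

Lemma clmulDr : right_distributive (@clmul R) +%R.
Proof.
move=> x y z; apply/ffunP => C; rewrite [RHS]ffunE !clmulE -big_split /=.
by apply: eq_bigr => A _; rewrite ffunE mulrDr.
Qed.

Lemma clone_neq0 : @clone R != 0 :> {ffun {set 'I_5} -> R}.
Proof.
by apply/eqP => /ffunP/(_ set0)/eqP; rewrite !ffunE eqxx oner_eq0.
Qed.

End Clifford.

HB.instance Definition _ (R : realType) := GRing.Zmodule.copy (Cl R) {ffun {set 'I_5} -> R}.
HB.instance Definition _ (R : realType) :=
  GRing.Zmodule_isNzRing.Build (Cl R) (@clmulA R) (@cl1mul R) (@clmul1 R)
    (@clmulDl R) (@clmulDr R) (@clone_neq0 R).

(** * The real algebra structure on the Clifford algebra *)

Section CliffordAlgebra.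
Variable R : realType.
Implicit Types (A B C : {set 'I_5}) (x y z : Cl R).

Definition clscale (a : R) (x : Cl R) : Cl R := [ffun A => a * x A].

Lemma clscaleA a b x : clscale a (clscale b x) = clscale (a * b) x.
Proof. by apply/ffunP => A; rewrite !ffunE mulrA. Qed.

Lemma clscale1 : left_id 1 clscale.
Proof. by move=> x; apply/ffunP => A; rewrite !ffunE mul1r. Qed.

Lemma clscaleDr : right_distributive clscale +%R.
Proof. by move=> a x y; apply/ffunP => A; rewrite !ffunE mulrDr. Qed.

Lemma clscaleDl x : {morph clscale^~ x : a b / a + b}.
Proof. by move=> a b; apply/ffunP => A; rewrite !ffunE mulrDl. Qed.

HB.instance Definition _ := GRing.Zmodule_isLmodule.Build R (Cl R)
  clscaleA clscale1 clscaleDr clscaleDl.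

Lemma clscaleAl (a : R) x y : a *: (x * y) = a *: x * y.
Proof.
apply/ffunP => C; rewrite [LHS]ffunE !clmulE mulr_sumr.
by apply: eq_bigr => A _; rewrite ffunE; ring.
Qed.

HB.instance Definition _ := GRing.Lmodule_isLalgebra.Build R (Cl R) clscaleAl.

Lemma clscaleAr (a : R) x y : a *: (x * y) = x * (a *: y).
Proof.
apply/ffunP => C; rewrite [LHS]ffunE !clmulE mulr_sumr.
by apply: eq_bigr => A _; rewrite ffunE; ring.
Qed.

HB.instance Definition _ := GRing.Lalgebra_isAlgebra.Build R (Cl R) clscaleAr.

Lemma clDE x y A : (x + y) A = x A + y A. Proof. by rewrite ffunE. Qed.
Lemma clNE x A : (- x) A = - x A. Proof. by rewrite ffunE. Qed.
Lemma clZE a x A : (a *: x) A = a * x A. Proof. by rewrite ffunE. Qed.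
Lemma clmE x y : clmul x y = x * y. Proof. by []. Qed.
Lemma cl1E : clone R = 1. Proof. by []. Qed.

End CliffordAlgebra.

(** * The spin group *)

Section Spin.
Variable R : realType.
Implicit Types (A B C : {set 'I_5}) (x y z s t : Cl R) (v w n : 'cV[R]_5).

(** Multiplying by the inversion signs leaves only the product of [qsq] over the intersection, which
    is symmetric. *)
Lemma blade_sign_swap A B :
  blade_sign R A B * bichar (@inversion_sign R) A B =
  blade_sign R B A * bichar (@inversion_sign R) B A.
Proof.
rewrite /blade_sign !inversion_count setIC mulrAC [RHS]mulrAC.
by rewrite !bichar_sqr //; exact: inversion_sign_sqr.
Qed.

(** The reversion sign is quadratic in the blade. Its cross terms at [symdiff A B] are the inversion
    signs that [blade_sign_swap] trades for exchanging the two factors. *)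
Lemma clrevM x y : clrev (x * y) = clrev y * clrev x.
Proof.
apply/ffunP => C; rewrite clrevE !clmulE mulr_sumr.
rewrite [RHS](reindex_inj (can_inj (symdiffK C))); apply: eq_bigr => A _ /=.
have -> : symdiff (symdiff C A) C = A by rewrite (symdiffC C) -symdiffA symdiffss symdiffs0.
rewrite !clrevE (symdiffC C A); move: (symdiffK A C); move: (symdiff A C) => B <-.
have I2 := @inversion_sign_sqr R.
rewrite !(bicharDl, bicharDr) //; move: (blade_sign_swap A B) (bichar_sqr A B I2) (bichar_sqr B A I2).
set a := bichar _ A B; set b := bichar _ B A; set c := bichar _ A A; set d := bichar _ B B.
set e := blade_sign _ _ _; set f := blade_sign _ _ _ => ef aa bb.
have -> : c * a * (b * d) * (e * x A * y B) = c * b * d * x A * y B * (e * a) by ring.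
rewrite ef; ring: bb.
Qed.

Lemma clrevD x y : clrev (x + y) = clrev x + clrev y.
Proof. by apply/ffunP => A; rewrite clDE !ffunE mulrDr. Qed.

Lemma clrevN x : clrev (- x) = - clrev x.
Proof. by apply/ffunP => A; rewrite clNE !ffunE mulrN. Qed.

Lemma clrevK : involutive (@clrev R).
Proof.
move=> x; apply/ffunP => A; rewrite !clrevE mulrA bichar_sqr ?mul1r //.
exact: inversion_sign_sqr.
Qed.

Lemma clrev1 : clrev (1 : Cl R) = 1.
Proof.
apply/ffunP => A; rewrite clrevE -cl1E ffunE; case: eqP => [->|_]; last by rewrite mulr0.
by rewrite /bichar big_set0 mul1r.
Qed.

(** Only products of a blade with itself reach the scalar part. It therefore behaves like a trace
    and is invariant under conjugation. *)
Lemma scalar_part_mulC x y : (x * y) set0 = (y * x) set0.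
Proof.
rewrite -!clmE !clmulE; apply: eq_bigr => A _.
by rewrite symdiffs0 mulrAC.
Qed.

Definition blade A : Cl R := [ffun B : {set 'I_5} => (B == A)%:R].

Lemma blade0 : blade set0 = 1.
Proof. by []. Qed.

Lemma bladeM A B : blade A * blade B = blade_sign R A B *: blade (symdiff A B).
Proof.
apply/ffunP => C; rewrite clZE !clmulE (bigD1 A) //= big1 ?addr0 => [|D neDA].
  rewrite !ffunE eqxx mulr1 symdiff_eq [C == _]eq_sym symdiff_eq eq_sym.
  by case: eqP => [->|_]; rewrite ?mulr1 ?mulr0.
by rewrite ffunE (negbTE neDA) mulr0 mul0r.
Qed.

Lemma blade_mulE A x C : (blade A * x) C = blade_sign R A (symdiff A C) * x (symdiff A C).
Proof.
rewrite -clmE clmulE (bigD1 A) //= big1 ?addr0 => [|D neDA].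
  by rewrite ffunE eqxx mulr1.
by rewrite ffunE (negbTE neDA) mulr0 mul0r.
Qed.

Lemma mul_bladeE A x C : (x * blade A) C = blade_sign R (symdiff A C) A * x (symdiff A C).
Proof.
rewrite -clmE clmulE (bigD1 (symdiff A C)) //= big1 ?addr0 => [|D neD].
  by rewrite ffunE -symdiffA symdiffss symdiffs0 eqxx mulr1.
rewrite ffunE; case: eqP => [e|_]; last by rewrite mulr0.
by case/eqP: neD; rewrite -e -symdiffA symdiffss symdiffs0.
Qed.

Lemma cl_sum_blade x : x = \sum_A x A *: blade A.
Proof.
apply/ffunP => C; rewrite sum_ffunE (bigD1 C) //= big1 ?addr0 => [|A neA].
  by rewrite clZE ffunE eqxx mulr1.
by rewrite clZE ffunE eq_sym (negbTE neA) mulr0.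
Qed.

(* The left regular representation is faithful, so a one-sided inverse is two-sided. *)
Lemma cl_mul1C x y : x * y = 1 -> y * x = 1.
Proof.
pose M x : 'M[R]_#|{set 'I_5}| := \matrix_(i, j) (x * blade (enum_val j)) (enum_val i).
have MM (u t : Cl R) : M (u * t) = M u *m M t.
  apply/matrixP => i j; rewrite !mxE -mulrA.
  rewrite [t * _ in LHS]cl_sum_blade mulr_sumr sum_ffunE.
  rewrite (reindex (fun k : 'I_#|{set 'I_5}| => enum_val k)) /=; last by exists enum_rank => k _; [exact: enum_valK | exact: enum_rankK].
  by apply: eq_bigr => k _; rewrite !mxE -scalerAr clZE mulrC.
have M1 : M 1 = 1%:M.
  apply/matrixP => i j; rewrite !mxE mul1r ffunE.
  by rewrite (inj_eq enum_val_inj).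
have Minj (u t : Cl R) : M u = M t -> u = t.
  move=> e; apply/ffunP => C; have := congr1 (fun m : 'M_ _ => m (enum_rank C) (enum_rank set0)) e.
  by rewrite !mxE !enum_rankK blade0 !mulr1.
by move=> xy; apply: Minj; rewrite M1 MM; apply: mulmx1C; rewrite -MM xy M1.
Qed.

Definition cv v : Cl R := clvec (fun i => v i 0).

Lemma cvE v A : cv v A = \sum_i (A == [set i])%:R * v i 0.
Proof. by rewrite ffunE. Qed.

Lemma cv_linear : linear cv.
Proof.
move=> a v w; apply/ffunP => A; rewrite clDE clZE !cvE mulr_sumr -big_split /=.
by apply: eq_bigr => i _; rewrite !mxE; ring.
Qed.
HB.instance Definition _ := GRing.isLinear.Build R 'cV[R]_5 (Cl R) _ cv cv_linear.

Lemma cvZ a v : cv (a *: v) = a *: cv v.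
Proof. exact: linearZ. Qed.

Lemma clvecE (f : 'I_5 -> R) : clvec f = cv (\col_i f i).
Proof. by apply/ffunP => A; rewrite !ffunE; apply: eq_bigr => i _; rewrite mxE. Qed.

Lemma cv1 v i : cv v [set i] = v i 0.
Proof.
rewrite cvE (bigD1 i) //= big1 ?addr0 ?eqxx ?mul1r // => j neij.
by rewrite (inj_eq set1_inj) eq_sym (negbTE neij) mul0r.
Qed.

Lemma cv_inj : injective cv.
Proof. by move=> v w e; apply/colP => i; rewrite -!cv1 e. Qed.

Lemma cv_delta i : cv (delta_mx i 0) = blade [set i].
Proof.
apply/ffunP => A; rewrite cvE ffunE (bigD1 i) //= big1 ?addr0 => [|j neij].
  by rewrite mxE !eqxx mulr1.
by rewrite mxE (negbTE neij) mulr0.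
Qed.

Lemma is_vectorP x : is_vector x <-> exists v, x = cv v.
Proof.
split=> [xv|[v ->]].
  exists (\col_i x [set i]); apply/ffunP => A.
  case: (boolP (#|A| == 1%N)) => [/cards1P[i ->]|A1]; first by rewrite cv1 mxE.
  rewrite xv // cvE big1 // => i _; case: eqP => [e|_]; last by rewrite mul0r.
  by rewrite e cards1 in A1.
move=> A A1; rewrite cvE big1 // => i _; case: eqP => [e|_]; last by rewrite mul0r.
by rewrite e cards1 in A1.
Qed.

Lemma clrev_cv v : clrev (cv v) = cv v.
Proof.
apply/ffunP => A; rewrite ffunE.
case: (boolP (#|A| == 1%N)) => [/eqP ->|A1]; first by rewrite mul1r.
by have /is_vectorP/(_ A A1) -> : exists w, cv v = cv w; [exists v | rewrite mulr0].
Qed.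

Definition lform v w : R := \sum_i qsq R i * v i 0 * w i 0.

Lemma lformC v w : lform v w = lform w v.
Proof. by apply: eq_bigr => i _; rewrite mulrAC. Qed.

Lemma lformE v w : lform v w = (v^T *m lorJ R *m w) 0 0.
Proof.
rewrite mxE; apply: eq_bigr => i _; congr (_ * _).
rewrite mxE (bigD1 i) //= big1 ?addr0 => [|j neji].
  by rewrite !mxE eqxx mulrC /qsq.
by rewrite !mxE (negbTE neji) mulr0.
Qed.

Lemma cv_sum v : cv v = \sum_i v i 0 *: blade [set i].
Proof.
rewrite {1}[v](matrix_sum_delta v) exchange_big big_ord1 raddf_sum /=.
by apply: eq_bigr => i _; rewrite cvZ cv_delta.
Qed.

Lemma pair_sign_swap (i j : 'I_5) :
  pair_sign R i j * pair_sign R j i = if i == j then 1 else -1.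
Proof.
rewrite /pair_sign /inversion_sign; case: eqVneq => [->|].
  by rewrite ltnn !mul1r qsq_sqr.
by rewrite neq_ltn; case: ltngtP => //= _ _; ring.
Qed.

Lemma blade_sign11 i j : blade_sign R [set i] [set j] = pair_sign R i j.
Proof. by rewrite blade_signE /bichar !big_set1. Qed.

Lemma blade1_anticomm i j :
  blade [set i] * blade [set j] + blade [set j] * blade [set i] =
  (if i == j then 2 * qsq R i else 0) *: 1.
Proof.
rewrite !bladeM (symdiffC [set j]) -scalerDl !blade_sign11.
case: eqVneq => [->|ne].
  rewrite symdiffss blade0 /pair_sign /inversion_sign eqxx ltnn.
  by congr (_ *: _); ring.
have := pair_sign_swap i j; have := pair_sign_sqr R j i; rewrite (negbTE ne).
move=> e1 e2; rewrite -[X in (X + _) *: _]mulr1 -e1 mulrA e2 mulN1r addNr.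
by rewrite !scale0r.
Qed.

Lemma cv_anticomm v w : cv v * cv w + cv w * cv v = (2 * lform v w) *: 1.
Proof.
rewrite !cv_sum !mulr_suml.
under eq_bigr => i _ do rewrite mulr_sumr.
under [X in _ + X]eq_bigr => i _ do rewrite mulr_sumr.
rewrite [X in _ + X]exchange_big -big_split /= mulr_sumr scaler_suml.
apply: eq_bigr => i _; rewrite -big_split /=.
under eq_bigr => j _.
  rewrite -!scalerAl -!scalerAr !scalerA (mulrC (w j 0)) -scalerDr blade1_anticomm scalerA.
  over.
rewrite -scaler_suml; congr (_ *: _).
rewrite (bigD1 i) //= big1 ?addr0 => [|j neji]; first by rewrite eqxx; ring.
by rewrite eq_sym (negbTE neji) mulr0.
Qed.

Lemma cv_sqr v : cv v * cv v = lform v v *: 1.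
Proof.
have e := cv_anticomm v v.
have n2 : (2 : R) != 0 by rewrite pnatr_eq0.
apply: (scalerI n2); rewrite scalerA -e scaler_nat mulr2n //.
Qed.

Lemma Spinplus_unit s : Spinplus s -> s * clrev s = 1.
Proof. by case=> _ []. Qed.

Lemma Spinplus_inv s : Spinplus s -> clrev s * s = 1.
Proof. by case=> _ [ss _]; exact: cl_mul1C. Qed.

(** [eta] records only the degree-one coefficients of the images of the basis vectors; nothing is
    lost, since conjugation by [s] sends vectors to vectors. *)
Lemma Spinplus_act s v : Spinplus s -> s * cv v * clrev s = cv (eta s *m v).
Proof.
case=> _ [_ sv]; have e i : s * cv (delta_mx i 0) * clrev s = cv (col i (eta s)).
  have /is_vectorP[w ew] := sv (fun k => (k == i)%:R).
  move: (ew); rewrite clvecE !clmE.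
  have -> : \col_k (k == i)%:R = delta_mx i 0 :> 'cV[R]_5.
    by apply/colP => k; rewrite !mxE eqxx andbT.
  move=> ->; congr cv; apply/colP => k.
  by rewrite !mxE ew cv1.
rewrite {1}[v](matrix_sum_delta v) exchange_big big_ord1 raddf_sum /=.
rewrite mulr_sumr mulr_suml.
transitivity (\sum_i cv (v i 0 *: col i (eta s))).
  by apply: eq_bigr => i _; rewrite !cvZ -scalerAr -scalerAl e.
rewrite -raddf_sum; congr cv; apply/colP => k; rewrite mxE summxE.
by apply: eq_bigr => i _; rewrite !mxE mulrC.
Qed.

Lemma is_even1 : is_even (1 : Cl R).
Proof. by move=> A oA; rewrite -cl1E ffunE; case: eqP oA => // ->; rewrite cards0. Qed.

Lemma odd_symdiff A B : odd #|symdiff A B| = odd #|A| (+) odd #|B|.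
Proof.
have key (D : {set 'I_5}) : (-1) ^+ odd #|D| = \prod_(i in D) (-1) :> R.
  by rewrite signr_odd prodr_const.
have ff (i : 'I_5) : (-1) * (-1) = 1 :> R by ring.
have := prod_symdiff A B ff; rewrite -!key -signr_addb.
by move/(@signr_inj _ _ _).
Qed.

Lemma is_evenM x y : is_even x -> is_even y -> is_even (x * y).
Proof.
move=> ex ey C oC; rewrite -clmE clmulE big1 // => A _.
case oA: (odd #|A|); first by rewrite ex // mulr0 mul0r.
by rewrite (ey (symdiff A C)) ?mulr0 // odd_symdiff oA oC.
Qed.

Lemma SpinplusP s (M : 'M[R]_5) : is_even s -> s * clrev s = 1 ->
  (forall v, s * cv v * clrev s = cv (M *m v)) -> Spinplus s /\ eta s = M.
Proof.
move=> es ss sv; have Ss : Spinplus s.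
  split=> //; split=> // f; rewrite clvecE; apply/is_vectorP.
  by exists (M *m \col_i f i); rewrite -sv.
split=> //; apply/matrixP => i j.
have := sv (delta_mx j 0); rewrite Spinplus_act // => /cv_inj.
by rewrite -!colE => /colP/(_ i); rewrite !mxE.
Qed.

Lemma Spinplus1 : Spinplus (1 : Cl R) /\ eta (1 : Cl R) = 1%:M.
Proof.
apply: SpinplusP; rewrite ?clrev1 ?mulr1 //; first exact: is_even1.
by move=> v; rewrite mul1r mulr1 mul1mx.
Qed.

Lemma SpinplusM s t : Spinplus s -> Spinplus t ->
  Spinplus (s * t) /\ eta (s * t) = eta s *m eta t.
Proof.
move=> Ss St; have [es _] := Ss; have [et _] := St.
have a u : s * t * u * clrev (s * t) = s * (t * u * clrev t) * clrev s.
  by rewrite clrevM !mulrA.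
apply: SpinplusP => [||v]; first exact: is_evenM.
  by have := a 1; rewrite !mulr1 (Spinplus_unit St) mulr1 (Spinplus_unit Ss).
by rewrite a !Spinplus_act // mulmxA.
Qed.

Lemma SpinplusN s : Spinplus s -> Spinplus (- s) /\ eta (- s) = eta s.
Proof.
move=> Ss; have [es _] := Ss; apply: SpinplusP => [A oA||v].
- by rewrite clNE es ?oppr0.
- by rewrite clrevN mulrNN Spinplus_unit.
- by rewrite clrevN mulrN !mulNr opprK Spinplus_act.
Qed.

(** Conjugation preserves the square of [cv v], which is the scalar [lform v v]; polarization gives
    the bilinear form. *)
Lemma eta_lorentz s : Spinplus s -> (eta s)^T *m lorJ R *m eta s = lorJ R.
Proof.
move=> Ss; have q v : lform (eta s *m v) (eta s *m v) = lform v v.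
  have sc (a b : R) : a *: 1 = b *: 1 :> Cl R -> a = b.
    by move=> /ffunP/(_ set0); rewrite !clZE -cl1E ffunE eqxx !mulr1.
  apply: sc; rewrite -!cv_sqr -!Spinplus_act //.
  rewrite -mulrA (mulrA (clrev s)) (mulrA (clrev s)) Spinplus_inv // mul1r.
  by rewrite !mulrA -(mulrA s (cv v)) cv_sqr -scalerAr mulr1 -scalerAl; rewrite Spinplus_unit.
have b v w : lform (eta s *m v) (eta s *m w) = lform v w.
  have D u u' : lform (u + u') (u + u') = lform u u + lform u' u' + 2 * lform u u'.
    by rewrite mulr_sumr -!big_split; apply: eq_bigr => i _ /=; rewrite !mxE; ring.
  have := q (v + w); rewrite mulmxDr !D !q; lra.
apply/matrixP => i j; have := b (delta_mx i 0) (delta_mx j 0).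
have g (A : 'M[R]_5) : A i j = ((delta_mx i 0 : 'cV_5)^T *m A *m (delta_mx j 0 : 'cV_5)) 0 0.
  by rewrite trmx_delta -rowE -colE !mxE.
by rewrite !lformE => e; rewrite [LHS]g [RHS]g -e trmx_mul !mulmxA.
Qed.

Lemma lorJ_sqr : lorJ R *m lorJ R = 1%:M.
Proof.
apply/matrixP => i j; rewrite !mxE (bigD1 i) //= big1 ?addr0 => [|k neki].
  rewrite !mxE eqxx; case: (eqVneq i j) => _; rewrite ?mulr0 //.
  by case: (i == 0); rewrite ?mulrNN mulr1.
by rewrite !mxE eq_sym (negbTE neki) mul0r.
Qed.

Lemma eta_unit s : Spinplus s -> eta s \in unitmx.
Proof.
move=> Ss; suff /mulmx1_unit[] : (lorJ R *m (eta s)^T *m lorJ R) *m eta s = 1%:M by [].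
by rewrite -!mulmxA (mulmxA _ (lorJ R)) eta_lorentz // lorJ_sqr.
Qed.

Lemma Spinplus_rev s : Spinplus s ->
  Spinplus (clrev s) /\ eta (clrev s) = invmx (eta s).
Proof.
move=> Ss; apply: SpinplusP => [A oA||v].
- by case: Ss => es _; rewrite clrevE es ?mulr0.
- by rewrite clrevK Spinplus_inv.
rewrite -{1}(mulKVmx (eta_unit Ss) v) -Spinplus_act // clrevK.
by rewrite !mulrA Spinplus_inv // mul1r -mulrA Spinplus_inv // mulr1.
Qed.

(** Such a [z] commutes with every [e_i], whereas a blade of even size containing [i] anticommutes
    with [e_i]. As [z] is even, only its scalar part survives, and [z * clrev z = 1] makes the
    square of that scalar 1. *)
Lemma eta_ker z : Spinplus z -> eta z = 1%:M -> z = 1 \/ z = -1.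
Proof.
move=> Sz ez; have zc i : z * blade [set i] = blade [set i] * z.
  rewrite -cv_delta -[in RHS](mul1mx (delta_mx i 0)) -ez -Spinplus_act //.
  by rewrite -!mulrA Spinplus_inv // mulr1.
have z0 A : A != set0 -> z A = 0.
  move=> A0; case oA: (odd #|A|); first by case: Sz => ->.
  have [i iA] := set0Pn _ A0; have := congr1 (fun x : Cl R => x (symdiff [set i] A)) (zc i).
  rewrite /= mul_bladeE blade_mulE !symdiffK => e.
  have s1 : blade_sign R [set i] A * blade_sign R A [set i] = -1.
    rewrite !blade_signE /bichar big_set1; under [X in _ * X]eq_bigr => j _ do rewrite big_set1.
    rewrite -big_split /=; under eq_bigr => j _ do rewrite pair_sign_swap.
    (* The factor at [j = i] is 1 and the other [#|A| - 1] factors, odd in number, are -1. *)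
    rewrite (bigD1 i) //= eqxx mul1r.
    rewrite (eq_bigr (fun=> -1)) => [|j /andP[_ /negbTE]]; last by rewrite eq_sym => ->.
    rewrite (eq_bigl (mem (A :\ i))) => [|j]; last by rewrite !inE andbC.
    rewrite prodr_const -signr_odd; move: oA; rewrite (cardsD1 i A) iA.
    by rewrite add1n /= => /negbFE ->.
  have s2 := blade_sign_sqr R [set i] A.
  have : z A = - z A.
    rewrite -[LHS]mul1r -s2 -mulrA -e mulrA s1 mulN1r //.
  lra.
have zs : z = z set0 *: 1.
  apply/ffunP => A; rewrite clZE -cl1E ffunE; case: eqP => [->|/eqP A0]; rewrite ?mulr1 //.
  by rewrite (z0 A) // mulr0.
have := Spinplus_unit Sz; rewrite zs.
have -> : clrev (z set0 *: 1) = z set0 *: 1 :> Cl R.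
  by apply/ffunP => A; rewrite ffunE clZE mulrCA; congr (_ * _); have := clrev1; move=> /ffunP/(_ A); rewrite ffunE.
rewrite -scalerAl mul1r scalerA => /ffunP/(_ set0); rewrite clZE -cl1E ffunE eqxx mulr1.
move=> /eqP; rewrite -expr2 sqrf_eq1 => /orP[] /eqP ->; [left | right].
  by rewrite scale1r.
by rewrite scaleN1r.
Qed.

Lemma eta_fiber s t : Spinplus s -> Spinplus t -> eta s = eta t ->
  s = t \/ s = - t.
Proof.
move=> Ss St e; have [Sr er] := Spinplus_rev St.
have [Sz ez] := SpinplusM Sr Ss.
have {}ez : eta (clrev t * s) = 1%:M by rewrite ez er e mulVmx // eta_unit.
have -> : s = t * (clrev t * s) by rewrite mulrA Spinplus_unit // mul1r.
by case: (eta_ker Sz ez) => ->; [left; rewrite mulr1 | right; rewrite mulrN1].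
Qed.

Lemma Spinplus_conj s x : Spinplus s -> Spinplus x ->
  Spinplus (s * x * clrev s) /\ eta (s * x * clrev s) = eta s *m eta x *m invmx (eta s).
Proof.
move=> Ss Sx; have [Sr er] := Spinplus_rev Ss; have [Ssx esx] := SpinplusM Ss Sx.
by have [S e] := SpinplusM Ssx Sr; rewrite e esx er.
Qed.

Lemma scalar_part_conj s x : Spinplus s -> (s * x * clrev s) set0 = x set0.
Proof. by move=> Ss; rewrite scalar_part_mulC mulrA Spinplus_inv // mul1r. Qed.
End Spin.

(** * Reflections generate SO^+(4,1) *)

Section Reflections.
Variable R : realType.
Implicit Types (s t : Cl R) (u v w n : 'cV[R]_5) (f : 'M[R]_5).

Lemma lformDl u v w : lform (u + v) w = lform u w + lform v w.
Proof. by rewrite -big_split; apply: eq_bigr => i _; rewrite !mxE /=; ring. Qed.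

Lemma lformZl a v w : lform (a *: v) w = a * lform v w.
Proof. by rewrite mulr_sumr; apply: eq_bigr => i _; rewrite !mxE /=; ring. Qed.

Lemma lformDr u v w : lform w (u + v) = lform w u + lform w v.
Proof. by rewrite lformC lformDl !(lformC w). Qed.

Lemma lformZr a v w : lform w (a *: v) = a * lform w v.
Proof. by rewrite lformC lformZl (lformC w). Qed.

Lemma lform_delta i j : lform (delta_mx i 0) (delta_mx j 0) = lorJ R i j.
Proof.
rewrite /lform (bigD1 i) //= big1 ?addr0 => [|k neki].
  by rewrite !mxE !eqxx /= andbT mulr1 /qsq; case: (i == j); rewrite ?mulr1 ?mulr0.
by rewrite !mxE (negbTE neki) mulr0 mul0r.
Qed.

Definition lorentz f := f^T *m lorJ R *m f = lorJ R.

Lemma lorentz_lform f v w : lorentz f -> lform (f *m v) (f *m w) = lform v w.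
Proof. by move=> lf; rewrite !lformE trmx_mul -[in RHS]lf !mulmxA. Qed.

Lemma lorentzM f g : lorentz f -> lorentz g -> lorentz (f *m g).
Proof.
rewrite /lorentz => lf lg.
by rewrite trmx_mul !mulmxA -(mulmxA g^T) -(mulmxA g^T) lf.
Qed.

Definition refl n : 'M[R]_5 := 1%:M - 2 *: (n *m n^T *m lorJ R).

Lemma refl_act n v : refl n *m v = v - (2 * lform n v) *: n.
Proof.
rewrite mulmxBl mul1mx -scalemxAl -!mulmxA (mulmxA n^T).
by rewrite [n^T *m lorJ R *m v]mx11_scalar -lformE mul_mx_scalar scalerA.
Qed.

Lemma reflK n : lform n n = 1 -> refl n *m refl n = 1%:M.
Proof.
move=> n1; have e v : refl n *m refl n *m v = v.
  rewrite -mulmxA !refl_act -!scaleNr lformDr lformZr n1.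
  rewrite -addrA -scalerDl -[RHS]addr0; congr (_ + _).
  by rewrite -[RHS](scale0r n); congr (_ *: _); ring.
by apply/matrixP => i j; have := e (delta_mx j 0); rewrite -colE => /colP/(_ i); rewrite !mxE andbT.
Qed.

Lemma lorJ_tr : (lorJ R)^T = lorJ R.
Proof. by apply/matrixP => i j; rewrite !mxE eq_sym; case: eqP => // ->. Qed.

Lemma lorentz_refl n : lform n n = 1 -> lorentz (refl n).
Proof.
move=> n1; suff e : (refl n)^T *m lorJ R = lorJ R *m refl n.
  by rewrite /lorentz e -mulmxA reflK // mulmx1.
rewrite /refl linearB linearZ /= trmx1 !trmx_mul trmxK lorJ_tr.
by rewrite mulmxBl mulmxBr mul1mx mulmx1 -scalemxAl -scalemxAr !mulmxA.
Qed.

(** Both products in [e] equal the block matrix with rows [1, c] and [r, 1]; their determinants are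
    compared. *)
Lemma det_1_sub_rank1 m (c : 'cV[R]_m) (r : 'rV[R]_m) :
  \det (1%:M - c *m r) = 1 - (r *m c) 0 0.
Proof.
have e : block_mx (1%:M - c *m r) c 0 1%:M *m block_mx 1%:M 0 r 1%:M =
    block_mx 1%:M 0 r 1%:M *m block_mx 1%:M c 0 (1%:M - r *m c) :> 'M_(m + 1).
  rewrite !mulmx_block !mul1mx !mulmx1 !mul0mx !mulmx0 !add0r !addr0 subrK.
  by rewrite [r *m c + _]addrC subrK.
have := congr1 (@determinant _ _) e; rewrite !det_mulmx !det_ublock !det_lblock !det1 !mul1r !mulr1.
by move=> ->; rewrite det_mx11 !mxE.
Qed.

Lemma det_refl n : lform n n = 1 -> \det (refl n) = -1.
Proof.
move=> n1; rewrite /refl -!mulmxA scalemxAr det_1_sub_rank1 -scalemxAl.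
rewrite mxE -lformE n1; ring.
Qed.

(** Conjugation by a unit normal is minus the reflection; for a product of two reflections the signs
    cancel. *)
Lemma cv_refl n v : lform n n = 1 -> cv n * cv v * cv n = - cv (refl n *m v).
Proof.
move=> n1; have := cv_anticomm n v => /(canRL (addrK _)) ->.
rewrite refl_act mulrBl -mulrA cv_sqr n1 scale1r mulr1 -scalerAl mul1r.
by rewrite raddfB /= cvZ opprB.
Qed.

Lemma Spinplus_pair m n : lform m m = 1 -> lform n n = 1 ->
  Spinplus (cv m * cv n) /\ eta (cv m * cv n) = refl m *m refl n.
Proof.
move=> m1 n1; apply: SpinplusP => [C oC||v].
- rewrite -clmE clmulE big1 // => A _.
  have cv0 v (B : {set 'I_5}) : ~~ odd #|B| -> cv v B = 0.
    have /is_vectorP : exists w, cv v = cv w by exists v.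
    by move=> vv eB; apply: vv; apply: contra eB => /eqP ->.
  case oA: (odd #|A|); last by rewrite cv0 ?oA // mulr0 mul0r.
  by rewrite (cv0 n) ?mulr0 //; have := odd_symdiff R A C; rewrite oC oA => ->.
- rewrite clrevM !clrev_cv -mulrA (mulrA (cv n)) cv_sqr n1 scale1r mul1r.
  by rewrite cv_sqr m1 scale1r.
rewrite clrevM !clrev_cv -!mulrA (mulrA (cv v)) (mulrA (cv n)) (mulrA (cv n)) cv_refl //.
by rewrite mulNr mulrN mulrA cv_refl // opprK mulmxA.
Qed.

(** Even products of reflections lift to the spin group, odd ones after one reflection is split off.
    The determinant later tells the two cases apart. *)
Definition spin_or_refl f := exists s, [/\ Spinplus s, \det (eta s) = 1 &
  eta s = f \/ exists n, lform n n = 1 /\ f = refl n *m eta s].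

Lemma spin_or_refl_mul n f : lform n n = 1 -> spin_or_refl f -> spin_or_refl (refl n *m f).
Proof.
move=> n1 [s [Ss ds [<-|[m [m1 ->]]]]]; first by exists s; split=> //; right; exists n.
have [Sp ep] := Spinplus_pair n1 m1; have [Sq eq] := SpinplusM Sp Ss.
exists (cv n * cv m * s); split=> //; last by left; rewrite eq ep mulmxA.
by rewrite eq ep !det_mulmx !det_refl // ds; ring.
Qed.

Definition spatial_norm v : R := \sum_(i < 5 | i != 0) v i 0 ^+ 2.

Lemma lform_spatial v : lform v v = spatial_norm v - v 0 0 ^+ 2.
Proof.
rewrite /lform (bigD1 0) //= addrC; congr (_ + _); last by rewrite /qsq eqxx; ring.
by apply: eq_bigr => i /negbTE i0; rewrite /qsq i0; ring.
Qed.

Lemma spatial_norm_ge0 v : 0 <= spatial_norm v.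
Proof. by apply: sumr_ge0 => i _; rewrite sqr_ge0. Qed.

Lemma spatial_norm_eq0 v : spatial_norm v = 0 -> forall i, i != 0 -> v i 0 = 0.
Proof.
move=> v0 i i0; have := psumr_eq0P (fun j _ => sqr_ge0 (v j 0)) v0.
by move=> /(_ i i0)/eqP; rewrite sqrf_eq0 => /eqP.
Qed.

(* A Lorentz matrix fixing e_0, ..., e_(k-1) maps e_k to w with w - e_k spacelike or zero, so the
   reflection in w - e_k brings w back to e_k. *)
Lemma lorentz_spin_or_refl k f : (k <= 5)%N -> lorentz f -> 0 < f 0 0 ->
  (forall i : 'I_5, (i < 5 - k)%N -> f *m delta_mx i 0 = delta_mx i 0 :> 'cV_5) ->
  spin_or_refl f.
Proof.
elim: k f => [|k IH] f lek lf f00 fix_f.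
  have -> : f = 1%:M.
    apply/matrixP => i j; have := fix_f j; rewrite subn0 ltn_ord => /(_ erefl).
    by rewrite -colE => /colP/(_ i); rewrite !mxE andbT.
  have [S1 e1] := Spinplus1 R; exists 1; rewrite e1 det1; split=> //; by left.
have k4 : (5 - k.+1 < 5)%N by lia.
pose j := Ordinal k4; set e : 'cV[R]_5 := delta_mx j 0.
pose w := f *m e; pose x := w - e.
have below (i : 'I_5) : (i < 5 - k)%N -> i = j \/ (i < 5 - k.+1)%N.
  move=> ik; have [|] := ltnP i (5 - k.+1)%N; first by right.
  by move=> ki; left; apply: val_inj => /=; lia.
have next g : lorentz g -> g *m e = e ->
    (forall i : 'I_5, (i < 5 - k.+1)%N -> g *m delta_mx i 0 = delta_mx i 0 :> 'cV_5) ->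
    spin_or_refl g.
  move=> lg ge gfix.
  have fix_g (i : 'I_5) : (i < 5 - k)%N -> g *m delta_mx i 0 = delta_mx i 0 :> 'cV_5.
    by case/below => [->|/gfix].
  apply: IH => //; first by lia.
  have := fix_g 0; rewrite subn_gt0 => /(_ lek); rewrite -colE => /colP/(_ 0); rewrite !mxE eqxx => ->.
  exact: ltr01.
have [x0|x0] := eqVneq x 0; first by apply: next => //; apply/eqP; rewrite -subr_eq0 -/w -/x x0.
have ww : lform w w = lform e e by apply: lorentz_lform.
(* Since [w] and [e] have the same norm, this identity holds, and it says that the reflection in [x]
   sends [w] to [w - x = e]. *)
have qx : lform x x = 2 * lform x w.
  rewrite /x lformDl -scaleN1r !lformDr !lformDl !lformZl !lformZr ww (lformC w e); ring.
have q_gt0 : 0 < lform x x.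
  have ee := lform_delta j j; rewrite -/e !mxE eqxx in ee.
  (* For [e = e_0] the norm of [x] is [2 * (w_0 - 1)]. On the upper sheet [w_0] is at least 1, with
     equality only at [e_0]. *)
  have [j0|j0] := eqVneq j 0.
    have w0 : w 0 0 = f 0 0 by rewrite /w /e j0 -colE mxE.
    have wS : spatial_norm w = w 0 0 ^+ 2 - 1.
      by have := ww; rewrite lform_spatial ee j0 eqxx; lra.
    have xS : spatial_norm x = spatial_norm w.
      by apply: eq_bigr => i /negbTE i0; rewrite !mxE j0 i0 subr0.
    have xx : lform x x = 2 * (w 0 0 - 1).
      rewrite lform_spatial xS wS (_ : x 0 0 = w 0 0 - 1); first by ring.
      by rewrite [LHS]mxE [X in _ + X]mxE [X in _ - X]mxE j0 !eqxx.
    have S0 := spatial_norm_ge0 w; rewrite wS in S0; rewrite -w0 in f00.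
    rewrite xx; have [w1|w1|w1] := ltrgtP (w 0 0) 1; [|by rewrite mulr_gt0 ?subr_gt0|].
      by have : w 0 0 ^+ 2 < 1; [rewrite expr_lt1 // ltW | rewrite -subr_lt0 ltNge S0].
    case/eqP: x0; apply/colP => i; rewrite [RHS]mxE.
    have [->|i0] := eqVneq i 0.
      by rewrite [LHS]mxE w1 [X in _ + X]mxE [X in _ - X]mxE j0 !eqxx subrr.
    by apply: spatial_norm_eq0 => //; rewrite xS wS w1; ring.
  have jgt : (0 < 5 - k.+1)%N by rewrite lt0n; apply: contra j0 => /eqP j0; apply/eqP/val_inj.
  (* Orthogonality to the fixed vector [e_0] makes [w], hence [x], purely spatial. *)
  have w0 : w 0 0 = 0.
    have := lorentz_lform (delta_mx 0 0) e lf; rewrite fix_f // -/w lform_delta mxE eq_sym (negbTE j0).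
    rewrite /lform (bigD1 0) //= big1 => [|i i0]; last by rewrite mxE (negbTE i0) mulr0 mul0r.
    by rewrite mxE /qsq !eqxx mulr1 mulN1r addr0 => /eqP; rewrite oppr_eq0 => /eqP.
  have xt : x 0 0 = 0 by rewrite [LHS]mxE w0 !mxE eq_sym (negbTE j0) subr0.
  rewrite lform_spatial xt expr0n /= subr0 lt_def spatial_norm_ge0 andbT.
  apply: contra x0 => /eqP xS; apply/eqP/colP => i; rewrite [RHS]mxE.
  by have [->|i0] := eqVneq i 0; [exact: xt | exact: spatial_norm_eq0].
have [a a0 sq] : exists2 a, a != 0 & a ^+ 2 = lform x x.
  exists (Num.sqrt (lform x x)); last exact: sqr_sqrtr (ltW q_gt0).
  by rewrite sqrtr_eq0 -ltNge.
pose n := a^-1 *: x.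
have n1 : lform n n = 1.
  by rewrite lformZl lformZr -sq; field.
have rn v : refl n *m v = v - (2 * lform x v / lform x x) *: x.
  by rewrite refl_act lformZl scalerA -sq; congr (_ - _ *: _); field.
rewrite -[f]mul1mx -(reflK n1) -mulmxA; apply: spin_or_refl_mul => //.
apply: next.
- exact: lorentzM (lorentz_refl n1) lf.
- rewrite -mulmxA -/w rn -qx divff ?gt_eqF // scale1r /x; by rewrite opprB addrC subrK.
- move=> i ik; rewrite -mulmxA fix_f // rn.
  (* The vectors already fixed have equal products with [w] and with [e], so they are orthogonal to
     [x] and stay fixed. *)
  have -> : lform x (delta_mx i 0) = 0.
    rewrite /x lformDl -scaleN1r lformZl -{1}(fix_f i ik) lorentz_lform //; ring.
  by rewrite mulr0 mul0r scale0r subr0.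
Qed.

Lemma eta_surjective f : SOplus f -> exists s, Spinplus s /\ eta s = f.
Proof.
case=> lf [df f00].
have [|s [Ss ds [<-|[n [n1 fE]]]]] := @lorentz_spin_or_refl 5 f (leqnn _) lf f00.
- by move=> i; rewrite subnn.
- by exists s.
(* An extra reflection would make the determinant -1. *)
by move: df; rewrite fE det_mulmx det_refl // ds; lra.
Qed.
End Reflections.

(** * The vertices of the 600-cell *)

(* The pair (a, b) stands for a + b phi. *)
Definition zphi_mul (x y : int * int) : int * int :=
  (x.1 * y.1 + x.2 * y.2, x.1 * y.2 + x.2 * y.1 + x.2 * y.2).

Definition zphi_sub (x y : int * int) : int * int := (x.1 - y.1, x.2 - y.2).

Definition zphi_sign (e : bool) (x : int * int) : int * int :=
  if e then (- x.1, - x.2) else x.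

Definition zphi_dot (x y : seq (int * int)) : int * int :=
  foldr (fun p r => let q := zphi_mul p.1 p.2 in (q.1 + r.1, q.2 + r.2)) (0, 0) (zip x y).

Definition swap (a b x : nat) := if a == x then b else if b == x then a else x.

(* Parity of a permutation of {0, 1, 2, 3} given by its list of values: each step moves
   the value k to position k by one transposition. *)
Definition list_parity (q : seq nat) : bool :=
  let fix_at q k := [seq swap (nth 0 q k) k x | x <- q] in
  let q1 := fix_at q 0%N in let q2 := fix_at q1 1%N in
  (nth 0 q 0 != 0) (+) (nth 0 q1 1 != 1) (+) (nth 0 q2 2 != 2).

Definition even_lists := [seq q <- permutations [:: 0; 1; 2; 3] | ~~ list_parity q]%N.

Definition bools4 : seq (seq bool) :=
  foldr (fun _ l => [seq false :: e | e <- l] ++ [seq true :: e | e <- l]) [:: [::]] (iota 0 4).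

(** Twice [base600], using [1 / phi = phi - 1]. *)
Definition base600_zphi : seq (int * int) := [:: (0, 1); (1, 0); (-1, 1); (0, 0)].

Definition axis_vertex (i : nat) (e : bool) : seq (int * int) :=
  [seq if j == i then zphi_sign e (2, 0) else (0, 0) | j <- iota 0 4].

Definition cube_vertex (e : seq bool) : seq (int * int) := [seq zphi_sign b (1, 0) | b <- e].

(** Position [i] receives the base coordinate whose index [q] sends to [i], which matches [u (p j)]
    in [facet_dir]. *)
Definition base_vertex (q : seq nat) (e : seq bool) : seq (int * int) :=
  [seq let j := index i q in zphi_sign (nth false e j) (nth (0, 0) base600_zphi j) | i <- iota 0 4].

(* Twice the 120 vertices. *)
Definition vertices : seq (seq (int * int)) :=
  [seq axis_vertex i e | i <- iota 0 4, e <- [:: false; true]] ++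
  [seq cube_vertex e | e <- bools4] ++
  [seq base_vertex q e | q <- even_lists, e <- bools4].

(** When [x] is twice a unit vector, the reflection of [y] is [y - (x.y / 2) x]; doubling it avoids
    the division. *)
Definition double_reflection (x y : seq (int * int)) : seq (int * int) :=
  [seq zphi_sub (zphi_mul (2, 0) p.2) (zphi_mul (zphi_dot x y) p.1) | p <- zip x y].

(** For doubled vectors, [(4, 0)] is the squared length and [(-2, 2)] is four times cos(2pi/5). The
    repetitions removed by [undup] come from signs put on the zero coordinate. *)
Lemma vertices_ok :
  let l := undup vertices in
  let l2 := [seq map (zphi_mul (2, 0)) x | x <- l] in
  all (fun x => [&& zphi_dot x x == (4, 0), has (fun y => zphi_dot x y == (-2, 2)) l &
    all (fun y => double_reflection x y \in l2) l]) l.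
Proof. by vm_compute. Qed.

Lemma size_vertex x : x \in vertices -> size x = 4%N.
Proof.
have : all (fun x => size x == 4%N) vertices by vm_compute.
by move=> /allP h /h/eqP.
Qed.

Definition perm_list (p : 'S_4) : seq nat := [seq val (p (inord i)) | i <- iota 0 4].

Definition bool_list (e : 'I_4 -> bool) : seq bool := [seq e (inord i) | i <- iota 0 4].

Lemma nth_perm_list (p : 'S_4) (k : 'I_4) : nth 0%N (perm_list p) k = p k.
Proof. by rewrite (nth_map 0%N) ?size_iota // nth_iota // inord_val. Qed.

Lemma uniq_perm_list (p : 'S_4) : uniq (perm_list p).
Proof.
rewrite map_inj_in_uniq ?iota_uniq // => i j; rewrite !mem_iota /= => i4 j4.
by move=> /val_inj/perm_inj/(congr1 val); rewrite /= !inordK.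
Qed.

Lemma nth_bool_list e (k : 'I_4) : nth false (bool_list e) k = e k.
Proof. by rewrite (nth_map 0%N) ?size_iota // nth_iota // inord_val. Qed.

Lemma mem_bool_list e : bool_list e \in bools4.
Proof.
by rewrite /bool_list /=; case: (e _); case: (e _); case: (e _); case: (e _).
Qed.

Lemma swap_tperm (a b x : 'I_4) : val (tperm a b x) = swap a b x.
Proof.
rewrite /swap; case: tpermP => [->|->|xa xb]; first by rewrite eqxx.
  by rewrite eqxx; case: eqP => // /val_inj.
by case: eqP => [/val_inj/esym//|_]; case: eqP => // /val_inj/esym.
Qed.

Lemma perm_list_swap (p : 'S_4) (k : 'I_4) :
  [seq swap (nth 0 (perm_list p) k) k x | x <- perm_list p]%N = perm_list (p * tperm (p k) k)%g.
Proof.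
rewrite nth_perm_list -map_comp; apply: eq_map => i /=.
by rewrite permM swap_tperm.
Qed.

(** Composing [p] with the three transpositions of [list_parity] fixes 0, 1, 2 in turn, hence also
    3. So the parity of [p] is that of the number of nontrivial transpositions. *)
Lemma odd_perm_list (p : 'S_4) : list_parity (perm_list p) = odd_perm p.
Proof.
pose k0 : 'I_4 := inord 0; pose k1 : 'I_4 := inord 1; pose k2 : 'I_4 := inord 2.
pose k3 : 'I_4 := inord 3.
pose p1 := (p * tperm (p k0) k0)%g; pose p2 := (p1 * tperm (p1 k1) k1)%g.
pose p3 := (p2 * tperm (p2 k2) k2)%g.
have v0 : val k0 = 0%N by rewrite /= inordK.
have v1 : val k1 = 1%N by rewrite /= inordK.
have v2 : val k2 = 2%N by rewrite /= inordK.
have v3 : val k3 = 3%N by rewrite /= inordK.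
have l1 := perm_list_swap p k0; have l2 := perm_list_swap p1 k1.
have n0 := nth_perm_list p k0; have n1 := nth_perm_list p1 k1; have n2 := nth_perm_list p2 k2.
rewrite -/p1 -/p2 -?[nat_of_ord _]/(val _) ?v0 ?v1 ?v2 in l1 l2 n0 n1 n2.
have val_neq (a k : 'I_4) m : val k = m -> (val a != m) = (a != k).
  by move=> <-; rewrite (inj_eq val_inj).
rewrite /list_parity l1 l2 n0 n1 n2 (val_neq _ _ _ v0) (val_neq _ _ _ v1) (val_neq _ _ _ v2).
have keep (q : 'S_4) a b : q a = a -> b != a -> (q * tperm (q b) b)%g a = a.
  by move=> qa ne; rewrite permM qa tpermD // -[X in _ != X]qa (inj_eq perm_inj).
have fix0 : p1 k0 = k0 by rewrite permM tpermL.
have fix1 : p2 k1 = k1 by rewrite permM tpermL.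
have d10 : k1 != k0 by rewrite -(val_neq _ _ _ v0) v1.
have d20 : k2 != k0 by rewrite -(val_neq _ _ _ v0) v2.
have d21 : k2 != k1 by rewrite -(val_neq _ _ _ v1) v2.
have p3_id : p3 = 1%g.
  have f2 : p3 k2 = k2 by rewrite permM tpermL.
  have f1 : p3 k1 = k1 by apply: keep.
  have f0 : p3 k0 = k0 by apply: (keep) => //; apply: keep.
  have cases (i : 'I_4) : [\/ i = k0, i = k1, i = k2 | i = k3].
    case: i => [[|[|[|[|//]]]] lti]; [apply: Or41 | apply: Or42 | apply: Or43 | apply: Or44];
      by apply: val_inj; rewrite ?v0 ?v1 ?v2 ?v3.
  have f3 : p3 k3 = k3.
    by case: (cases (p3 k3)) => // e; move: (e); rewrite -{1}(f0, f1, f2) => /perm_inj/(congr1 val); rewrite v3 (v0, v1, v2).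
  by apply/permP => i; rewrite perm1; case: (cases i) => ->.
have := congr1 (@odd_perm _) p3_id; rewrite !odd_permM !odd_tperm odd_perm1.
by case: (odd_perm p); case: (_ != _); case: (_ != _); case: (_ != _).
Qed.

(** * The vertices as real vectors, and their symmetry *)

Section Vertices.
Variable R : realType.
Local Notation phi := (phi R).

Lemma sqrt5_sqr : Num.sqrt 5 * Num.sqrt 5 = 5 :> R.
Proof. by rewrite -expr2 sqr_sqrtr. Qed.

Lemma phi_sqr : phi * phi = phi + 1.
Proof. by have s5 := sqrt5_sqr; rewrite /Defs.phi; field: s5. Qed.

Lemma phi_gt0 : 0 < phi.
Proof. by rewrite /Defs.phi divr_gt0 ?ltr0n // addr_gt0 ?ltr01 // sqrtr_gt0 ltr0n. Qed.

Lemma phi_inv : phi^-1 = phi - 1.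
Proof.
have p0 : phi != 0 by rewrite gt_eqF ?phi_gt0.
by apply: (mulfI p0); rewrite divff // mulrBr phi_sqr; ring.
Qed.

Definition zphi (x : int * int) : R := x.1%:~R + x.2%:~R * phi.

Lemma zphiM x y : zphi (zphi_mul x y) = zphi x * zphi y.
Proof. by have p2 := phi_sqr; rewrite /zphi /= !rmorphD !rmorphM /=; ring: p2. Qed.

Lemma zphiB x y : zphi (zphi_sub x y) = zphi x - zphi y.
Proof. by rewrite /zphi /= !rmorphB /=; ring. Qed.

Lemma zphi_signE e x : zphi (zphi_sign e x) = (-1) ^+ e * zphi x.
Proof. by case: e; rewrite /zphi /= ?rmorphN /=; ring. Qed.

Definition vertex (x : seq (int * int)) (j : 'I_4) : R := zphi (nth (0, 0) x j) / 2.

Lemma zphi_dotE x y : size x = 4%N -> size y = 4%N ->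
  zphi (zphi_dot x y) = 4 * \sum_j vertex x j * vertex y j.
Proof.
case: x => [|x0 [|x1 [|x2 [|x3 []]]]] //; case: y => [|y0 [|y1 [|y2 [|y3 []]]]] // _ _.
have dot_cons a b l m : zphi (zphi_dot (a :: l) (b :: m)) = zphi a * zphi b + zphi (zphi_dot l m).
  by rewrite -zphiM /zphi !rmorphD /=; ring.
rewrite !dot_cons !big_ord_recl big_ord0 /vertex /=.
by rewrite [zphi (zphi_dot _ _)]/zphi /=; field.
Qed.

Lemma base600E j : base600 R j = zphi (nth (0, 0) base600_zphi j) / 2.
Proof.
by case: j => [[|[|[|[|//]]]] ?]; rewrite /base600 /zphi /= ?(invfM 2 phi) ?phi_inv; field.
Qed.

Lemma vertex_facet x : x \in vertices -> facet_dir (@vertex x).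
Proof.
rewrite mem_cat [X in _ || X]mem_cat => /or3P[x1 | /mapP[e e4 ->] | x3].
- have /allpairsP[[i e] [i4 _ ->]] := x1.
  rewrite mem_iota /= in i4; left; exists (Ordinal i4), e => j.
  rewrite /vertex (nth_map 0%N) ?size_iota // nth_iota // -(inj_eq val_inj) /=.
  by case: eqP => _; rewrite ?zphi_signE /zphi /=; field.
- right; left; exists (fun j => nth false e j) => j.
  rewrite /vertex (nth_map false) ?zphi_signE; first by rewrite /zphi /=; field.
  have : all (fun e => size e == 4%N) bools4 by [].
  by move=> /allP/(_ _ e4)/eqP ->.
have /allpairsP[[q e] [/= q4 e4 ->]] := x3.
right; right; move: q4; rewrite mem_filter mem_permutations => /andP[oq pq].
have sq : size q = 4%N by rewrite (perm_size pq).
have uq : uniq q by rewrite (perm_uniq pq).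
have ltq j : (j < 4)%N -> (nth 0 q j < 4)%N.
  move=> j4; have : nth 0%N q j \in q by rewrite mem_nth // sq.
  by rewrite (perm_mem pq) !inE; case/or4P => /eqP ->.
have inj : injective (fun j : 'I_4 => (inord (nth 0%N q j) : 'I_4)).
  move=> i j /(congr1 val); rewrite /= !inordK ?ltq // => /eqP.
  by rewrite nth_uniq ?sq // => /eqP/val_inj.
pose p := perm inj.
have pE j : val (p j) = nth 0%N q j by rewrite permE /= inordK ?ltq.
exists p; split.
  rewrite -odd_perm_list (_ : perm_list p = q) //.
  apply: (@eq_from_nth _ 0%N); rewrite size_map size_iota // => j j4.
  by rewrite (nth_map 0%N) ?size_iota // nth_iota // pE inordK.
exists (fun j => nth false e j) => j.
rewrite /vertex (nth_map 0%N) ?size_iota // nth_iota // [(_ + _)%N]pE index_uniq ?sq //.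
rewrite zphi_signE -mulrA; congr (_ * _).
by rewrite base600E.
Qed.

Lemma facet_vertex u : facet_dir u -> exists2 x, x \in vertices & u =1 @vertex x.
Proof.
case=> [[i [e ue]]|[[e ue]|[p [ep [e ue]]]]].
- exists (axis_vertex i e).
    rewrite mem_cat; apply/orP; left; apply: allpairs_f; last by case: (e).
    by rewrite mem_iota ltn_ord.
  move=> j; rewrite ue /vertex (nth_map 0%N) ?size_iota // nth_iota // -(inj_eq val_inj) /=.
  by case: eqP => _; rewrite ?zphi_signE /zphi /=; field.
- exists (cube_vertex (bool_list e)).
    by rewrite mem_cat [X in _ || X]mem_cat (map_f _ (mem_bool_list e)) orbT.
  move=> j; rewrite ue /vertex (nth_map false) ?zphi_signE ?nth_bool_list ?size_map //.
  by rewrite /zphi /=; field.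
exists (base_vertex (perm_list p) (bool_list e)).
  rewrite mem_cat [X in _ || X]mem_cat allpairs_f ?orbT ?mem_bool_list // mem_filter odd_perm_list ep mem_permutations.
  rewrite perm_sym uniq_perm ?uniq_perm_list //.
  move=> i; rewrite (_ : [:: 0; 1; 2; 3]%N = iota 0 4) // mem_iota /=.
  apply/idP/mapP => [i4|[j _ ->]]; last exact: ltn_ord.
  exists (val ((p^-1)%g (Ordinal i4))); first by rewrite mem_iota /=.
  by rewrite inord_val permKV.
move=> k; have [j ->] : exists j, k = p j by exists ((p^-1)%g k); rewrite permKV.
rewrite ue /vertex (nth_map 0%N) ?size_iota // nth_iota //.
rewrite -{1}nth_perm_list [(_ + _)%N]/(nth 0%N (perm_list p) j) index_uniq ?nth_bool_list //.
  by rewrite zphi_signE nth_bool_list base600E mulrA.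
exact: uniq_perm_list.
Qed.

Lemma facet_dir_ext (u v : 'I_4 -> R) : u =1 v -> facet_dir u -> facet_dir v.
Proof.
move=> uv [[i [e ue]]|[[e ue]|[p [ep [e ue]]]]]; [left | right; left | right; right].
- by exists i, e => j; rewrite -uv.
- by exists e => j; rewrite -uv.
by exists p; split=> //; exists e => j; rewrite -uv.
Qed.

Lemma zphi_scalar n : zphi (n, 0) = n%:~R.
Proof. by rewrite /zphi /= mul0r addr0. Qed.

Lemma facet_norm (u : 'I_4 -> R) : facet_dir u -> \sum_j u j * u j = 1.
Proof.
case/facet_vertex => x xV ux.
have /allP/(_ x) := vertices_ok; rewrite mem_undup => /(_ xV)/and3P[/eqP xx _ _].
under eq_bigr => j _ do rewrite !ux.
have := zphi_dotE (size_vertex xV) (size_vertex xV); rewrite xx zphi_scalar; lra.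
Qed.

(** The value is cos(2pi/5). Multiplied by [cosh_r = phi^2] it becomes [phi / 2], that is cos(pi/5),
    so the side normal of [u] makes the angle pi/5 with [w]. *)
Lemma facet_neighbour (u : 'I_4 -> R) : facet_dir u ->
  exists2 w, facet_dir w & \sum_j u j * w j = (phi - 1) / 2.
Proof.
case/facet_vertex => x xV ux.
have /allP/(_ x) := vertices_ok; rewrite mem_undup => /(_ xV)/and3P[_ /hasP[y]].
rewrite mem_undup => yV /eqP xy _; exists (vertex y); first exact: vertex_facet.
under eq_bigr => j _ do rewrite ux.
have := zphi_dotE (size_vertex xV) (size_vertex yV); rewrite xy /zphi /=; lra.
Qed.

(** This closure lets reflections in facet directions permute the side pairings by conjugation. *)
Lemma facet_reflection (u v : 'I_4 -> R) : facet_dir u -> facet_dir v ->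
  facet_dir (fun j => v j - 2 * (\sum_i u i * v i) * u j).
Proof.
case/facet_vertex => x xV ux; case/facet_vertex => y yV vy.
have /allP/(_ x) := vertices_ok; rewrite mem_undup => /(_ xV)/and3P[_ _ /allP/(_ y)].
rewrite mem_undup => /(_ yV)/mapP[z]; rewrite mem_undup => zV e.
apply: facet_dir_ext (vertex_facet zV) => j.
have sz := size_vertex zV; have sx := size_vertex xV; have sy := size_vertex yV.
have := congr1 (fun l => zphi (nth (0, 0) l j)) e; rewrite /double_reflection.
rewrite (nth_map ((0, 0), (0, 0))) ?size_zip ?sx ?sy ?minnn // nth_zip ?sx ?sy //=.
rewrite (nth_map (0, 0)) ?sz // zphiB !zphiM !zphi_scalar zphi_dotE // ux vy.
under [in X in _ -> X]eq_bigr => i _ do rewrite ux vy.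
rewrite /vertex; lra.
Qed.
End Vertices.

(** * Reduction modulo the fourth root of 5, and side pairings *)

Section Congruence.
Variable R : realType.
Implicit Types (x y : R) (s t : Cl R).

Definition root45 : R := Num.sqrt (Num.sqrt 5).
Local Notation p := root45.

Lemma root45_sqr : p ^+ 2 = Num.sqrt 5.
Proof. by rewrite sqr_sqrtr // sqrtr_ge0. Qed.

Lemma root45_pow4 : p ^+ 4 = 5.
Proof. by rewrite (exprM p 2 2) root45_sqr sqr_sqrtr. Qed.

(* The ring Z[1/2, p] with p ^ 4 = 5 and its ideal (p), whose residue field is F_5. *)
Definition in_ring x := exists k (a b c d : int),
  2 ^+ k * x = a%:~R + b%:~R * p + c%:~R * p ^+ 2 + d%:~R * p ^+ 3.

Definition in_ideal x := exists2 y, in_ring y & x = p * y.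

Lemma in_ringD x y : in_ring x -> in_ring y -> in_ring (x + y).
Proof.
move=> [k [a [b [c [d e]]]]] [l [a' [b' [c' [d' e']]]]].
exists (k + l)%N, (2 ^+ l * a + 2 ^+ k * a'), (2 ^+ l * b + 2 ^+ k * b'),
  (2 ^+ l * c + 2 ^+ k * c'), (2 ^+ l * d + 2 ^+ k * d').
rewrite !rmorphD !rmorphM !rmorphXn /= exprD mulrDr.
have -> : 2 ^+ k * 2 ^+ l * x = 2 ^+ l * (2 ^+ k * x) by ring.
have -> : 2 ^+ k * 2 ^+ l * y = 2 ^+ k * (2 ^+ l * y) by ring.
by rewrite e e'; ring.
Qed.

Lemma in_ringM x y : in_ring x -> in_ring y -> in_ring (x * y).
Proof.
move=> [k [a [b [c [d e]]]]] [l [a' [b' [c' [d' e']]]]].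
exists (k + l)%N, (a * a' + 5 * (b * d' + c * c' + d * b')),
  (a * b' + b * a' + 5 * (c * d' + d * c')),
  (a * c' + b * b' + c * a' + 5 * (d * d')), (a * d' + b * c' + c * b' + d * a').
rewrite !rmorphD !rmorphM !rmorphD !rmorphM /= exprD.
have -> : 2 ^+ k * 2 ^+ l * (x * y) = 2 ^+ k * x * (2 ^+ l * y) by ring.
rewrite e e'; have p4 := root45_pow4; ring: p4.
Qed.

Lemma in_ring_int (m : int) : in_ring m%:~R.
Proof. by exists 0%N, m, 0, 0, 0; rewrite !mul0r !addr0 expr0 mul1r. Qed.

Lemma in_ring_half : in_ring 2^-1.
Proof. by exists 1%N, 1, 0, 0, 0; rewrite !mul0r !addr0 expr1 divff ?pnatr_eq0. Qed.

Lemma in_ring_root45 : in_ring p.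
Proof. by exists 0%N, 0, 1, 0, 0; rewrite !mul0r !addr0 add0r expr0. Qed.

Lemma in_ring_phi : in_ring (phi R).
Proof.
rewrite /phi -root45_sqr expr2; apply: in_ringM in_ring_half.
by apply: in_ringD (in_ringM _ _); [exact: (in_ring_int 1) | exact: in_ring_root45 ..].
Qed.

Lemma in_ring0 : in_ring 0. Proof. exact: (in_ring_int 0). Qed.

Lemma in_ring_sum (I : finType) (F : I -> R) : (forall i, in_ring (F i)) -> in_ring (\sum_i F i).
Proof. by move=> FO; apply: (big_ind in_ring) => //; [exact: in_ring0 | exact: in_ringD]. Qed.

Lemma in_ideal0 : in_ideal 0.
Proof. by exists 0; [exact: in_ring0 | rewrite mulr0]. Qed.

Lemma in_idealD x y : in_ideal x -> in_ideal y -> in_ideal (x + y).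
Proof. by move=> [a Oa ->] [b Ob ->]; exists (a + b); [exact: in_ringD | rewrite mulrDr]. Qed.

Lemma in_idealM x y : in_ideal x -> in_ring y -> in_ideal (x * y).
Proof. by move=> [a Oa ->] Oy; exists (a * y); [exact: in_ringM | rewrite mulrA]. Qed.

Lemma in_ideal_root45 x : in_ring x -> in_ideal (p * x).
Proof. by exists x. Qed.

Lemma in_ideal_ring x : in_ideal x -> in_ring x.
Proof. by case=> a Oa ->; apply: in_ringM => //; exact: in_ring_root45. Qed.

Lemma in_idealN x : in_ideal x -> in_ideal (- x).
Proof. by move=> Px; rewrite -mulrN1; apply: in_idealM => //; exact: (in_ring_int (-1)). Qed.

Lemma in_ideal_sum (I : finType) (F : I -> R) : (forall i, in_ideal (F i)) -> in_ideal (\sum_i F i).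
Proof. by move=> FO; apply: (big_ind in_ideal) => //; [exact: in_ideal0 | exact: in_idealD]. Qed.

(* Taking norms down to Q(sqrt 5) and then to Q, a relation 2 ^ (k + 1) = p y forces 5 to
   divide a power of 2. *)
Lemma two_notin_ideal : ~ in_ideal 2.
Proof.
case=> y [k [a [b [c [d e]]]]] e2.
(* Multiplying [2 = p y] by [2 ^ k] and using [p ^ 4 = 5], the even powers of [p] are collected on
   the left and the odd ones on the right. *)
pose m : int := 2 ^+ k.+1 - 5 * d.
have s5 := sqrt5_sqr R; rewrite -!root45_sqr in s5; have p4 := root45_pow4.
have e3 : m%:~R - b%:~R * p ^+ 2 = p * (a%:~R + c%:~R * p ^+ 2) :> R.
  have -> : m%:~R = 2 ^+ k * 2 - p ^+ 4 * d%:~R :> R.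
    by rewrite p4 /m rmorphB rmorphM rmorphXn exprSr.
  rewrite [X in _ * X - _]e2 mulrCA e; ring.
pose A : int := m ^+ 2 + 5 * b ^+ 2 - 10 * a * c.
pose B : int := 2 * m * b + a ^+ 2 + 5 * c ^+ 2.
(* Squaring [e3] leaves only even powers of [p]; [A] and [B] collect the integer part and the
   coefficient of [p ^ 2]. *)
have AB : A%:~R = B%:~R * p ^+ 2 :> R.
  have e4 : (m%:~R - b%:~R * p ^+ 2) ^+ 2 = p ^+ 2 * (a%:~R + c%:~R * p ^+ 2) ^+ 2.
    by rewrite e3; ring.
  apply/eqP; rewrite -subr_eq0; move/eqP: e4; rewrite -subr_eq0 => /eqP <-.
  rewrite /A /B !(rmorphD, rmorphB, rmorphM, rmorphXn) /=.
  apply/eqP; ring: p4.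
have A2 : A ^+ 2 = 5 * B ^+ 2.
  apply: (@intr_inj R); rewrite rmorphXn rmorphM rmorphXn /= AB; ring: p4.
(* Modulo 5, [A2] gives [A = 0], then the formula for [A] gives [m = 0], and so a power of 2
   vanishes. *)
have f5 : (5 : int)%:~R = 0 :> 'F_5 by apply/val_inj.
have intF (z : int) : (5 * z)%:~R = 0 :> 'F_5 by rewrite rmorphM /= f5 mul0r.
have A0 : A%:~R = 0 :> 'F_5.
  have := congr1 (fun z : int => z%:~R : 'F_5) A2; rewrite intF rmorphXn /= => /eqP.
  by rewrite sqrf_eq0 => /eqP.
have m0 : m%:~R = 0 :> 'F_5.
  have : (m ^+ 2)%:~R = 0 :> 'F_5.
    have -> : m ^+ 2 = A + 5 * (2 * a * c - b ^+ 2) by rewrite /A; ring.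
    by rewrite rmorphD /= intF A0 addr0.
  by rewrite rmorphXn /= => /eqP; rewrite sqrf_eq0 => /eqP.
have : (2 ^+ k.+1)%:~R = 0 :> 'F_5.
  have -> : 2 ^+ k.+1 = m + 5 * d :> int by rewrite /m subrK.
  by rewrite rmorphD /= intF m0 addr0.
by rewrite rmorphXn /= => /eqP; rewrite expf_eq0.
Qed.

Definition cl_ideal s := forall A, in_ideal (s A).

Lemma cl_idealD s t : cl_ideal s -> cl_ideal t -> cl_ideal (s + t).
Proof. by move=> Ps Pt A; rewrite clDE; apply: in_idealD. Qed.

Lemma in_ring_blade_sign A B : in_ring (blade_sign R A B).
Proof.
have /eqP := blade_sign_sqr R A B; rewrite -expr2 sqrf_eq1 => /orP[] /eqP ->.
  exact: (in_ring_int 1).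
exact: (in_ring_int (-1)).
Qed.

Lemma cl_idealM s t : cl_ideal s -> (forall A, in_ring (t A)) -> cl_ideal (s * t).
Proof.
move=> Ps Ot C; rewrite -clmE clmulE; apply: in_ideal_sum => A.
by apply: in_idealM => //; rewrite mulrC; apply: in_idealM => //; exact: in_ring_blade_sign.
Qed.

Definition congr1_cl s := cl_ideal (s - 1).

Lemma congr1_cl1 : congr1_cl 1.
Proof. by rewrite /congr1_cl subrr => A; rewrite ffunE; exact: in_ideal0. Qed.

Lemma congr1_clM s t : congr1_cl s -> congr1_cl t -> congr1_cl (s * t).
Proof.
rewrite /congr1_cl => Ps Pt.
have -> : s * t - 1 = (s - 1) * (t - 1) + ((s - 1) + (t - 1)).
  by rewrite mulrBr mulr1 addrA subrK mulrBl mul1r addrA subrK.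
apply: cl_idealD; last exact: cl_idealD.
by apply: cl_idealM => // A; apply: in_ideal_ring.
Qed.

Lemma congr1_cl_rev s : congr1_cl s -> congr1_cl (clrev s).
Proof.
rewrite /congr1_cl -{2}(clrev1 R) -clrevN -clrevD => Ps A.
by rewrite ffunE -signr_odd; case: odd; rewrite ?mul1r ?mulN1r //; exact: in_idealN.
Qed.

Lemma congr1_cl_scalar s : congr1_cl s -> in_ideal (s set0 - 1).
Proof. by move=> /(_ set0); rewrite clDE clNE -cl1E [clone R _]ffunE eqxx. Qed.

(** Adding the two congruences would put 2 in the ideal. Thus the scalar part separates the two
    lifts of a matrix. *)
Lemma not_congr1_opp s : in_ideal (s set0 - 1) -> ~ in_ideal ((- s) set0 - 1).
Proof.
move=> Ps /in_idealD/(_ Ps)/in_idealN; rewrite clNE.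
have -> : - (- s set0 - 1 + (s set0 - 1)) = 2 by ring.
exact: two_notin_ideal.
Qed.

End Congruence.

(** * Spin lifts of the side pairings, and rotations normalizing the group *)

Section SidePairings.
Variable R : realType.
Implicit Types (u v w : 'I_4 -> R) (s t : Cl R).
Local Notation phi := (phi R).
Local Notation cosh_r := (cosh_r R).
Local Notation sinh_r := (sinh_r R).

Lemma cosh_r_add1 : cosh_r + 1 = root45 R * (root45 R * phi).
Proof.
rewrite mulrA -expr2 root45_sqr /Defs.cosh_r /Defs.phi; have s5 := sqrt5_sqr R.
by field: s5.
Qed.

(** [phi^4 - 1] factors as [phi^2 - 1 = phi] times [phi^2 + 1 = p^2 phi], and the nonnegative root
    is taken. *)
Lemma sinh_rE : sinh_r = root45 R * phi.
Proof.
rewrite /Defs.sinh_r -[RHS]ger0_norm; last first.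
  by rewrite mulr_ge0 ?sqrtr_ge0 // ltW // phi_gt0.
rewrite -sqrtr_sqr; congr Num.sqrt.
have := cosh_r_add1; rewrite /Defs.cosh_r => e.
have p2 := phi_sqr R.
have -> : (phi ^+ 2) ^+ 2 - 1 = (phi * phi - 1) * (phi ^+ 2 + 1) by ring.
by rewrite e p2; ring.
Qed.

Lemma sinh_r_sqr : sinh_r * sinh_r = cosh_r ^+ 2 - 1.
Proof.
rewrite -expr2 sqr_sqrtr // subr_ge0 -[X in X <= _](expr1n _ 2) ler_pXn2r ?nnegrE ?ler01 ?sqr_ge0 //.
by rewrite /Defs.cosh_r expr2 phi_sqr lerDr ltW ?phi_gt0.
Qed.

Definition direction u : 'cV[R]_5 := \col_k ext_dir u k.

Definition side_normal u : 'cV[R]_5 := sinh_r *: delta_mx 0 0 + cosh_r *: direction u.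

Lemma direction0 u : direction u 0 0 = 0.
Proof. by rewrite mxE. Qed.

Lemma direction_lift u j : direction u (lift ord0 j) 0 = u j.
Proof. by rewrite mxE /ext_dir /= inord_val. Qed.

Lemma lform_direction u v : lform (direction u) (direction v) = \sum_j u j * v j.
Proof.
rewrite /lform big_ord_recl direction0 mulr0 mul0r add0r; apply: eq_bigr => j _.
by rewrite !direction_lift /qsq /= mul1r.
Qed.

Lemma lform_e0 (v : 'cV[R]_5) : lform (delta_mx 0 0) v = - v 0 0.
Proof.
rewrite /lform (bigD1 0) //= big1 ?addr0 => [|i i0]; last by rewrite mxE (negbTE i0) mulr0 mul0r.
by rewrite mxE /qsq !eqxx mulr1 mulN1r.
Qed.

Lemma lform_side_normal u w : lform (side_normal u) (direction w) = cosh_r * \sum_j u j * w j.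
Proof. by rewrite lformDl !lformZl lform_direction lform_e0 direction0 oppr0 mulr0 add0r. Qed.

Lemma side_normalE u i : side_normal u i 0 = sinh_r * (i == 0)%:R + cosh_r * ext_dir u i.
Proof. by rewrite !mxE eqxx andbT. Qed.

Lemma side_normal_unit u : \sum_j u j * u j = 1 -> lform (side_normal u) (side_normal u) = 1.
Proof.
move=> u1; rewrite {2}/side_normal lformDr !lformZr lform_side_normal u1.
rewrite lformC lform_e0 side_normalE /ext_dir !eqxx /=; have s2 := sinh_r_sqr; ring: s2.
Qed.

(** Reflections in two hyperplanes perpendicular to the axis, at distance r from each other, compose
    to the translation by 2r along it. *)
Lemma side_pairingE u : \sum_j u j * u j = 1 ->
  side_pairing u = refl (side_normal u) *m refl (direction u).
Proof.
move=> u1; have s2 := sinh_r_sqr; apply/matrixP => i j.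
have <- : (refl (side_normal u) *m refl (direction u) *m delta_mx j 0 : 'cV[R]_5) i 0 =
    (refl (side_normal u) *m refl (direction u)) i j by rewrite -colE mxE.
rewrite -mulmxA !refl_act lformDr -scaleNr lformZr lform_side_normal u1.
have ej (v : 'cV[R]_5) : lform v (delta_mx j 0) = qsq R j * v j 0.
  rewrite /lform (bigD1 j) //= big1 ?addr0 => [|k kj]; last by rewrite !mxE (negbTE kj) mulr0.
  by rewrite !mxE !eqxx mulr1.
have coord (x y z : 'cV[R]_5) a b : (x + a *: y - b *: z) i 0 = x i 0 + a * y i 0 - b * z i 0 by rewrite !mxE.
have dirE k : direction u k 0 = ext_dir u k by rewrite mxE.
have deltaE : (delta_mx j 0 : 'cV[R]_5) i 0 = (i == j)%:R by rewrite mxE andbT.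
rewrite !coord !ej !side_normalE !dirE deltaE /side_pairing mxE /cosh_2r /sinh_2r /qsq.
case: (eqVneq i 0) => [->|i0]; case: (eqVneq j 0) => [->|j0]; rewrite /ext_dir ?eqxx ?(negbTE i0) ?(negbTE j0) /=; ring: s2.
Qed.

Definition side_lift u : Cl R := - (cv (side_normal u) * cv (direction u)).

Lemma side_lift_spin u : \sum_j u j * u j = 1 ->
  Spinplus (side_lift u) /\ eta (side_lift u) = side_pairing u.
Proof.
move=> u1; have d1 : lform (direction u) (direction u) = 1 by rewrite lform_direction.
have [S e] := Spinplus_pair (side_normal_unit u1) d1.
by have [SN eN] := SpinplusN S; rewrite eN e -side_pairingE.
Qed.

Lemma facet_in_ring u j : facet_dir u -> in_ring (u j).
Proof.
case/facet_vertex => x _ ->; apply: in_ringM; last exact: in_ring_half.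
apply: in_ringD; first exact: in_ring_int.
by apply: in_ringM; [exact: in_ring_int | exact: in_ring_phi].
Qed.

(* Modulo the fourth root of 5, cosh r = phi^2 = -1 and sinh r = 0; this fixes the sign of side_lift. *)
Lemma side_lift_congr1 u : facet_dir u -> congr1_cl (side_lift u).
Proof.
move=> uF; have u1 := facet_norm uF; rewrite /congr1_cl.
(* The term of the normal along [direction u] contributes a scalar, since that vector squares to
   1. *)
have -> : side_lift u - 1 = - ((cosh_r + 1) *: 1 + sinh_r *: (blade R [set 0] * cv (direction u))).
  rewrite /side_lift /side_normal raddfD /= !cvZ cv_delta mulrDl -!scalerAl cv_sqr.
  by rewrite lform_direction u1 scale1r scalerDl scale1r -opprD -addrA addrC.
move=> A; rewrite clNE; apply: in_idealN; rewrite clDE !clZE; apply: in_idealD.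
  rewrite cosh_r_add1 -mulrA; apply: in_ideal_root45; apply: in_ringM.
    by apply: in_ringM; [exact: in_ring_root45 | exact: in_ring_phi].
  by rewrite -cl1E ffunE; exact: (in_ring_int _ (_ : nat)).
rewrite sinh_rE -mulrA; apply: in_ideal_root45; apply: in_ringM; first exact: in_ring_phi.
rewrite blade_mulE; apply: in_ringM; first exact: in_ring_blade_sign.
rewrite cvE; apply: in_ring_sum => i; apply: in_ringM; first exact: (in_ring_int _ (_ : nat)).
rewrite mxE /ext_dir; case: ifP => _; first exact: in_ring0.
exact: facet_in_ring.
Qed.

Lemma Gamma_lift (g : 'M[R]_5) : Gamma g ->
  exists s, [/\ Spinplus s, eta s = g & congr1_cl s].
Proof.
elim=> [|_ [u [uF ->]]|{}g h _ [s [Ss <- s1]] _ [t [St <- t1]]|{}g _ [s [Ss <- s1]]].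
- by have [S e] := Spinplus1 R; exists 1; split=> //; exact: congr1_cl1.
- have [S e] := side_lift_spin (facet_norm uF).
  by exists (side_lift u); split=> //; exact: side_lift_congr1.
- by have [S e] := SpinplusM Ss St; exists (s * t); split=> //; exact: congr1_clM.
by have [S e] := Spinplus_rev Ss; exists (clrev s); split=> //; exact: congr1_cl_rev.
Qed.

Definition reflected u v : 'I_4 -> R := fun j => v j - 2 * (\sum_i u i * v i) * u j.

Lemma refl_direction u v : refl (direction u) *m direction v = direction (reflected u v).
Proof.
rewrite refl_act lform_direction; apply/colP => i; rewrite !mxE /ext_dir.
by case: (i == 0); rewrite ?mulr0 ?subr0.
Qed.

Lemma refl_side_normal u v : refl (direction u) *m side_normal v = side_normal (reflected u v).
Proof.
rewrite mulmxDr -!scalemxAr refl_direction refl_act; congr (_ *: _ + _).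
by rewrite lformC lform_e0 direction0 oppr0 mulr0 scale0r subr0.
Qed.

Lemma refl_conj (f : 'M[R]_5) n : lorentz f -> f *m refl n = refl (f *m n) *m f.
Proof.
move=> lf; apply/matrixP => i j.
have ext (M : 'M[R]_5) : M i j = (M *m delta_mx j 0 : 'cV[R]_5) i 0 by rewrite -colE mxE.
rewrite !ext -!mulmxA !refl_act lorentz_lform // mulmxBr -scalemxAr //.
Qed.

Lemma side_pairing_conj u v : facet_dir u -> facet_dir v ->
  refl (direction u) *m side_pairing v *m refl (direction u) = side_pairing (reflected u v).
Proof.
move=> uF vF; have d1 : lform (direction u) (direction u) = 1 by rewrite lform_direction facet_norm.
have lu := lorentz_refl d1.
rewrite !side_pairingE ?facet_norm //; last exact: facet_reflection.
rewrite mulmxA (refl_conj _ lu) -(mulmxA _ (refl (direction u))) (refl_conj _ lu).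
by rewrite -!mulmxA reflK // mulmx1 refl_direction refl_side_normal.
Qed.

Lemma invmx_eq (A B : 'M[R]_5) : A *m B = 1%:M -> invmx A = B.
Proof.
move=> AB; have [uA _] := mulmx1_unit AB.
by rewrite -[LHS]mulmx1 -AB mulmxA mulVmx // mul1mx.
Qed.

(** A reflection has determinant -1 and so lies outside SO^+(4,1), but conjugation by it permutes
    the generators; pairs of reflections then give elements of the normalizer. *)
Lemma Gamma_refl_conj u (g : 'M[R]_5) : facet_dir u -> Gamma g ->
  Gamma (refl (direction u) *m g *m refl (direction u)).
Proof.
move=> uF; have d1 : lform (direction u) (direction u) = 1 by rewrite lform_direction facet_norm.
have rr := reflK d1.
elim=> [|_ [v [vF ->]]|{}g h _ Gg _ Gh|{}g Gg' Gg].
- by rewrite mulmx1 rr; exact: gen_one.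
- rewrite side_pairing_conj //; apply: gen_elt; exists (reflected u v); split=> //.
  exact: facet_reflection.
- have := gen_mul Gg Gh; rewrite -!mulmxA (mulmxA (refl _) (refl _)) rr mul1mx //.
have [s [Ss gE _]] := Gamma_lift Gg'.
have gu : g \in unitmx by rewrite -gE eta_unit.
have := gen_inv Gg; rewrite (@invmx_eq _ (refl (direction u) *m invmx g *m refl (direction u))) //.
by rewrite !mulmxA -(mulmxA (_ *m g)) rr mulmx1 -(mulmxA _ g) mulmxV // mulmx1.
Qed.

Lemma rotation_normalizer u w : facet_dir u -> facet_dir w ->
  normalizer_Gamma (refl (direction u) *m refl (direction w)).
Proof.
move=> uF wF; have unit1 v : facet_dir v -> lform (direction v) (direction v) = 1.
  by move=> vF; rewrite lform_direction facet_norm.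
have ru := reflK (unit1 u uF); have rw := reflK (unit1 w wF).
set U := refl (direction u) in ru *; set W := refl (direction w) in rw *.
have fV : U *m W *m (W *m U) = 1%:M by rewrite -mulmxA (mulmxA W) rw mul1mx.
have fi := invmx_eq fV.
split; last split.
- split; first by apply: lorentzM; apply: lorentz_refl; apply: unit1.
  split; first by rewrite det_mulmx !det_refl ?unit1 // mulrNN mulr1.
  have -> : (U *m W) 0 0 = (U *m W *m delta_mx 0 0 : 'cV[R]_5) 0 0 by rewrite -colE [RHS]mxE.
  have fix0 v : refl (direction v) *m delta_mx 0 0 = delta_mx 0 0 :> 'cV[R]_5.
    by rewrite refl_act lformC lform_e0 direction0 oppr0 mulr0 scale0r subr0.
  by rewrite -mulmxA !fix0 mxE !eqxx ltr01.
- move=> g Gg; rewrite fi; have := Gamma_refl_conj uF (Gamma_refl_conj wF Gg).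
  by rewrite !mulmxA.
move=> h Gh; exists (W *m U *m h *m (U *m W)); split.
  by have := Gamma_refl_conj wF (Gamma_refl_conj uF Gh); rewrite !mulmxA.
rewrite fi !mulmxA -(mulmxA U W W) rw mulmx1 ru mul1mx.
by rewrite -!mulmxA (mulmxA W W) rw mul1mx ru mulmx1.
Qed.

(** When [a^2 = a + 1], the polynomial [X^2 - a X + 1] divides [X^5 + 1]. Both roots [phi] and
    [1 - phi] are used as [a]. *)
Lemma golden_pow5 (a : R) (z : Cl R) : a * a = a + 1 -> z * z = a *: z - 1 -> z ^+ 5 = -1.
Proof.
move=> a2 z2; have a1 : a * a - 1 = a by rewrite a2 addrK.
have z3 : z ^+ 3 = a *: z - a *: 1.
  rewrite exprS expr2 z2 mulrBr mulr1 -scalerAr z2 scalerBr scalerA.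
  by rewrite addrAC -[X in _ - X - _]scale1r -scalerBl a1.
have z4 : z ^+ 4 = z - a *: 1.
  rewrite exprS z3 mulrBr -!scalerAr mulr1 z2 scalerBr scalerA addrAC -scalerBl.
  by rewrite a2 addrAC subrr add0r scale1r.
by rewrite exprS z4 mulrBr -scalerAr mulr1 -expr2 expr2 z2 addrAC subrr add0r.
Qed.

Lemma cv_pair_sqr (m n : 'cV[R]_5) : lform m m = 1 -> lform n n = 1 ->
  (cv m * cv n) * (cv m * cv n) = (2 * lform m n) *: (cv m * cv n) - 1.
Proof.
move=> m1 n1; have := cv_anticomm m n => /(canRL (addKr _)) e.
rewrite -mulrA (mulrA (cv n)) e mulrDl mulrDr mulNr mulrN.
rewrite -!mulrA cv_sqr n1 scale1r mulr1 cv_sqr m1 scale1r -scalerAl mul1r -scalerAr addrC //.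
Qed.
End SidePairings.

(** * Spin structures *)

Section SpinStructures.
Variable R : realType.
Implicit Types (x y s t : Cl R) (hG : Cl R -> Prop).

Definition canonical_lift s :=
  Spinplus s /\ Gamma (eta s) /\ in_ideal (s set0 - 1).

Lemma congr1_canonical s : Spinplus s -> Gamma (eta s) -> congr1_cl s -> canonical_lift s.
Proof. by move=> Ss Gs s1; split=> //; split=> //; exact: congr1_cl_scalar. Qed.

(** One of the two lifts of [eta s] is congruent to 1, and the scalar part identifies it. The full
    congruence is what passes to products. *)
Lemma canonical_congr1 s : canonical_lift s -> congr1_cl s.
Proof.
case=> Ss [Gs s1]; have [t [St et t1]] := Gamma_lift Gs.
have [->//|e] := eta_fiber Ss St (esym et).
by rewrite e in s1; case: (not_congr1_opp (congr1_cl_scalar t1)).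
Qed.

Lemma canonical_inj x y : canonical_lift x -> canonical_lift y -> eta x = eta y -> x = y.
Proof.
case=> [Sx [_ x1]] [Sy [_ y1]] /(eta_fiber Sx Sy)[//|e].
by rewrite e in x1; case: (not_congr1_opp y1).
Qed.

Lemma canonical_spin_structure : spin_structure canonical_lift.
Proof.
split; first by move=> x [].
split.
  have [S e] := Spinplus1 R; apply: congr1_canonical => //; last exact: congr1_cl1.
  by rewrite e; exact: gen_one.
split.
  move=> x y hx hy; have [[Sx [Gx _]] [Sy [Gy _]]] := (hx, hy).
  have [S e] := SpinplusM Sx Sy; apply: congr1_canonical => //.
    by rewrite e; exact: gen_mul.
  by apply: congr1_clM; exact: canonical_congr1.
split.
  move=> x hx; have [Sx [Gx _]] := hx; have [S e] := Spinplus_rev Sx.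
  apply: congr1_canonical => //; first by rewrite e; exact: gen_inv.
  exact/congr1_cl_rev/canonical_congr1.
split; first exact: canonical_inj.
move=> g; split=> [Gg|[x [[_ [Gx _]] <-]]] //.
have [s [Ss sg s1]] := Gamma_lift Gg.
by exists s; split=> //; apply: congr1_canonical => //; rewrite sg.
Qed.

(** Any lift [s] of [f] works: conjugation by it preserves scalar parts, and [f] normalizes
    [Gamma]. *)
Lemma canonical_fully_symmetric : fully_symmetric canonical_lift.
Proof.
move=> f [fSO [fG Gf]]; have [s [Ss sf]] := eta_surjective fSO.
exists s; split; last by move=> x _; exists 1%:M; rewrite mul1mx sf; split=> //; exact: gen_one.
have [Sr er] := Spinplus_rev Ss.
split=> //; split=> [x [Sx [Gx x1]]|y [Sy [Gy y1]]].
  have [S e] := Spinplus_conj Ss Sx; split=> //.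
  by split; [rewrite e sf; exact: fG | rewrite !clmE scalar_part_conj].
exists (clrev s * y * s); split; last first.
  by rewrite !clmE !mulrA Spinplus_unit // mul1r -!mulrA Spinplus_unit // mulr1.
have [S e] := Spinplus_conj Sr Sy; have sc := scalar_part_conj y Sr.
rewrite clrevK in S e sc; split=> //; split; last by rewrite sc.
have [g [Gg yg]] := Gf _ Gy; have fu := eta_unit Ss; rewrite sf in fu.
have gE : invmx f *m (f *m g *m invmx f) *m f = g by rewrite !mulmxA mulVmx // mul1mx mulmxKV.
by rewrite e er sf invmxK yg gE.
Qed.

(** Full symmetry only yields some [s] over an element of [Gamma] times the rotation, so [s] is
    [y * t] up to sign with [y] in [hG]. The sign cancels in the conjugation, and [y] is undone
    inside [hG]. *)
Lemma full_symmetry_conj hG u w : spin_structure hG -> fully_symmetric hG ->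
  facet_dir u -> facet_dir w ->
  let t := cv (direction u) * cv (direction w) in
  forall x, hG x -> hG (t * x * clrev t).
Proof.
move=> [hS [h1 [hM [hV [hI hE]]]]] hF uF wF t x hx.
have unit1 (v : 'I_4 -> R) : facet_dir v -> lform (direction v) (direction v) = 1.
  by move=> vF; rewrite lform_direction facet_norm.
have [St et] := Spinplus_pair (unit1 u uF) (unit1 w wF); rewrite -/t in St et.
have [s [[Ss [sG _]] sf]] := hF _ (rotation_normalizer uF wF).
have SO1 : SOplus (1%:M : 'M[R]_5).
  by rewrite /SOplus trmx1 mul1mx mulmx1 det1 mxE eqxx ltr01.
have [g [Gg]] := sf _ SO1; rewrite !mulmx1 -et => sg.
have [y [hy yg]] := (hE g).1 Gg; have Sy := hS _ hy.
have [Syt eyt] := SpinplusM Sy St; rewrite -yg -eyt in sg.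
have conj_eq : s * x * clrev s = y * (t * x * clrev t) * clrev y.
  case: (eta_fiber Ss Syt sg) => ->; rewrite ?clrevN ?mulrN ?mulNr ?opprK clrevM !mulrA //.
have hc : hG (y * (t * x * clrev t) * clrev y) by rewrite -conj_eq; exact: sG.
have := hM _ _ (hM _ _ (hV _ hy) hc) hy.
by rewrite !clmE !mulrA Spinplus_inv // mul1r -!mulrA Spinplus_inv // mulr1.
Qed.

Lemma clrevX x n : clrev (x ^+ n) = clrev x ^+ n.
Proof. by elim: n => [|n IH]; rewrite ?clrev1 // exprS clrevM IH exprSr. Qed.

(** The left side telescopes to [(x t)^4 x r^4], and [t r = 1] may be inserted after the last
    [x]. *)
Lemma conj_product5 (T : pzRingType) (x t r : T) : t * r = 1 ->
  x * (t * (x * (t * (x * (t * (x * (t * x * r)) * r)) * r)) * r) = (x * t) ^+ 5 * r ^+ 5.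
Proof.
by move=> tr; rewrite !exprS !expr0 !mulr1 !mulrA -(mulrA _ t r) tr mulr1.
Qed.

(* With n the normal of the side, w a neighbouring direction and t = u w, both n w and t are
   rotations of order five in the spin group up to sign: (n w)^5 = -1 and t^5 = 1. If hG
   contained x = n u = - side_lift u, it would contain the product of the five conjugates of x
   by powers of t, which is (x t)^5 t^-5 = (n w)^5 = -1. *)
Lemma side_lift_mem hG u : spin_structure hG -> fully_symmetric hG -> facet_dir u ->
  hG (side_lift u).
Proof.
move=> hSp hF uF; have [hS [h1 [hM [hV [hI hE]]]]] := hSp.
have [w wF uw] := facet_neighbour uF.
have u1 := facet_norm uF; have w1 := facet_norm wF.
have Gu : Gamma (side_pairing u) by apply: gen_elt; exists u.
have [x [hx ex]] := (hE _).1 Gu; have [Sl el] := side_lift_spin u1.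
(* The element of [hG] over the side pairing is [side_lift u] or its opposite; the rest refutes the
   opposite. *)
have [<-//|xE] := eta_fiber (hS _ hx) Sl (etrans ex (esym el)).
rewrite /side_lift opprK in xE.
have conj := full_symmetry_conj hSp hF uF wF.
set t := cv (direction u) * cv (direction w) in conj.
have du : lform (direction u) (direction u) = 1 by rewrite lform_direction.
have dw : lform (direction w) (direction w) = 1 by rewrite lform_direction.
have [St et] := Spinplus_pair du dw; rewrite -/t in St et.
have p2 := phi_sqr R.
have xt : x * t = cv (side_normal u) * cv (direction w).
  by rewrite xE /t -mulrA (mulrA (cv (direction u))) cv_sqr du scale1r mul1r.
have xt5 : (x * t) ^+ 5 = -1.
  apply: (golden_pow5 p2); rewrite xt cv_pair_sqr ?side_normal_unit //.
  by congr (_ *: _ - _); rewrite lform_side_normal uw /cosh_r; field: p2.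
(* Here [t^2 = (phi - 1) t - 1], so [-t] satisfies the golden relation for the conjugate root
   [1 - phi], and [(-t)^5 = -1]. *)
have t5 : t ^+ 5 = 1.
  apply: oppr_inj; have := @golden_pow5 R (1 - phi R) (- t).
  rewrite exprNn -signr_odd /= expr1 mulN1r; apply.
    by ring: p2.
  rewrite mulrNN cv_pair_sqr // lform_direction uw scalerN -scaleNr.
  by congr (_ *: _ - _); field.
pose c := fun y => t * y * clrev t.
have step y : hG y -> hG (x * c y) by move=> hy; exact: (hM _ _ hx (conj _ hy)).
have h5 : hG (x * c (x * c (x * c (x * c x)))).
  by do 4! apply: (step _).
rewrite /c (conj_product5 _ (Spinplus_unit St)) xt5 -clrevX t5 clrev1 mulr1 in h5.
(* Now -1 lies in [hG] and has the same image as 1, against injectivity of [eta] on [hG]. *)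
have [S1 e1] := Spinplus1 R; have [_ eN] := SpinplusN S1.
have := hI _ _ h5 h1; rewrite eN => /(_ erefl)/eqP.
by rewrite cl1E -subr_eq0 -opprD oppr_eq0 -mulr2n -scaler_nat scaler_eq0 pnatr_eq0 oner_eq0.
Qed.

(** As [hG] contains every [side_lift u], it contains the lift congruent to 1 of each element of
    [Gamma]; injectivity of [eta] on either side gives equality. *)
Lemma spin_structure_unique hG : spin_structure hG -> fully_symmetric hG ->
  forall x, hG x <-> canonical_lift x.
Proof.
move=> hSp hF x; have [hS [h1 [hM [hV [hI hE]]]]] := hSp.
have lift g : Gamma g -> exists s, [/\ hG s, eta s = g & congr1_cl s].
  elim=> [|_ [u [uF ->]]|{}g h _ [s [hs <- s1]] _ [t [ht <- t1]]|{}g _ [s [hs <- s1]]].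
  - by have [S e] := Spinplus1 R; exists 1; split=> //; exact: congr1_cl1.
  - have [S e] := side_lift_spin (facet_norm uF).
    by exists (side_lift u); split; [exact: side_lift_mem | | exact: side_lift_congr1].
  - have [S e] := SpinplusM (hS _ hs) (hS _ ht).
    by exists (s * t); split; [exact: hM | | exact: congr1_clM].
  have [S e] := Spinplus_rev (hS _ hs).
  by exists (clrev s); split; [exact: hV | | exact: congr1_cl_rev].
split=> [hx|cx].
  have Gx : Gamma (eta x) by apply/hE; exists x.
  have [s [hs es s1]] := lift _ Gx.
  by rewrite (hI _ _ hx hs (esym es)); apply: congr1_canonical; rewrite ?es //; exact: hS.
have [Sx [Gx _]] := cx; have [s [hs es s1]] := lift _ Gx.
rewrite (canonical_inj cx _ (esym es)) //.
by apply: congr1_canonical; rewrite ?es //; exact: hS.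
Qed.
End SpinStructures.

Theorem theorem3p2 (R : realType) :
  exists hG : Cl R -> Prop,
    spin_structure hG /\ fully_symmetric hG /\
    (forall hG' : Cl R -> Prop, spin_structure hG' -> fully_symmetric hG' ->
       forall x, hG' x <-> hG x).
Proof.
exists (@canonical_lift R); split; first exact: canonical_spin_structure.
split; first exact: canonical_fully_symmetric.
by move=> hG'; exact: spin_structure_unique.
Qed.
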